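(* Let $E$ be a closed subset of the unit circle $\mathbb T$. The following conditions are equivalent: (a) $E$ has zero length and finite entropy; (b) $\sum|J|<\infty$, where the sum is taken over all dyadic arcs $J$ such that $J\cap E\ne\varnothing$; (c) for any (finite) positive singular measure $\mu$ whose support is contained in $E$ and any $C>0$ one has $\sum|J|<\infty$, where the sum is taken over all dyadic arcs $J\subset\mathbb T$ such that $P[\mu](z(J))\ge C$.
   Context: $\mathbb D$ is the open unit disc, $\mathbb T=\partial\mathbb D$, and $|E|$ denotes normalized length ($|\mathbb T|=1$). A closed set $E\subset\mathbb T$ with $|E|=0$ has finite entropy if $\sum_k|J_k|\log|J_k|^{-1}<\infty$, where $(J_k)_k$ are the connected components of $\mathbb T\setminus E$. Identifying $\mathbb T$ with $[0,2\pi)$, the dyadic arcs are $[2\pi k2^{-n},2\pi(k+1)2^{-n})$, $0\le k<2^n$, $n\ge0$; such an arc has normalized length $2^{-n}$. For an arc $J\subset\mathbb T$ with center $\xi_J$, $z(J)=(1-\tfrac34|J|)\xi_J\in\mathbb D$. For a finite measure $\mu$ on $\mathbb T$, $P[\mu](z)=\int_{\mathbb T}\frac{1-|z|^2}{|\xi-z|^2}\,d\mu(\xi)$ is its Poisson integral. ''Singular'' means singular with respect to Lebesgue measure on $\mathbb T$; supports are closed supports. *)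

(* Defs.v *)
From HB Require Import structures.
From mathcomp Require Import all_boot all_order all_algebra.
From mathcomp Require Import all_classical all_reals all_analysis.

Set Implicit Arguments.
Unset Strict Implicit.
Unset Printing Implicit Defensive.

Import Order.TTheory GRing.Theory Num.Theory.
Import numFieldNormedType.Exports.

Local Open Scope classical_set_scope.
Local Open Scope ring_scope.

(* The complex plane is R * R: z = x + iy is (x, y).  Its library topology and
   sigma-algebra are the Euclidean topology and the Borel sigma-algebra; its
   library norm is the sup norm, so the squared modulus is written out. *)

Definition sqmod (R : realType) (z : R * R) : R := z.1 ^+ 2 + z.2 ^+ 2.

Definition circle (R : realType) : set (R * R) := [set z | sqmod z = 1].
Arguments circle R : clear implicits.

(* e^{it} *)
Definition expi (R : realType) (t : R) : R * R := (cos t, sin t).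

(* |A|, with |circle| = 1 *)
Definition arclength (R : realType) (A : set (R * R)) : \bar R :=
  (((2 * pi)^-1)%:E *
   lebesgue_measure (`[0%R, (2 * pi)%R[ `&` @expi R @^-1` A))%E.

Definition complementary_arcs (R : realType) (E : set (R * R)) :
    set (set (R * R)) :=
  [set connected_component (circle R `\` E) x | x in circle R `\` E].

Definition finite_entropy (R : realType) (E : set (R * R)) : Prop :=
  (\esum_(J in complementary_arcs E)
     (fine (arclength J) * ln (fine (arclength J))^-1)%:E < +oo)%E.

(* The dyadic arcs are indexed by pairs p = (n, k) with k < 2 ^ n; distinct
   pairs give distinct arcs. *)
Definition dyadic_index : set (nat * nat) := [set p | (p.2 < 2 ^ p.1)%N].

Definition dyadic_angle (R : realType) (n k : nat) : R :=
  2 * pi * k%:R / 2 ^+ n.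
Arguments dyadic_angle R n k : clear implicits.

Definition dyadic_arc (R : realType) (p : nat * nat) : set (R * R) :=
  @expi R @` `[dyadic_angle R p.1 p.2, dyadic_angle R p.1 p.2.+1[.
Arguments dyadic_arc R p : clear implicits.

Definition dyadic_center (R : realType) (p : nat * nat) : R * R :=
  expi ((dyadic_angle R p.1 p.2 + dyadic_angle R p.1 p.2.+1) / 2).
Arguments dyadic_center R p : clear implicits.

(* z(J) for J = dyadic_arc R p *)
Definition dyadic_point (R : realType) (p : nat * nat) : R * R :=
  let r := 1 - 3 / 4 * fine (arclength (dyadic_arc R p)) in
  (r * (dyadic_center R p).1, r * (dyadic_center R p).2).
Arguments dyadic_point R p : clear implicits.

(* Measures on the circle are measures on R * R whose closed support lies in
   the circle. *)
Definition closed_support (R : realType)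
    (mu : {measure set (R * R) -> \bar R}) : set (R * R) :=
  [set x | forall U : set (R * R), open U -> U x -> (0 < mu U)%E].

Definition singular (R : realType) (mu : {measure set (R * R) -> \bar R}) :
    Prop :=
  exists N : set (R * R),
    [/\ measurable N, arclength N = 0%E & mu (~` N) = 0%E].

Definition poisson (R : realType) (mu : {measure set (R * R) -> \bar R})
    (z : R * R) : \bar R :=
  (\int[mu]_(xi in circle R) ((1 - sqmod z) / sqmod (xi - z))%:E)%E.

(* Main.v *)
Require Import Defs.
From HB Require Import structures.
From mathcomp Require Import all_boot all_order all_algebra.
From mathcomp Require Import all_classical all_reals all_analysis.
From mathcomp Require Import measurable_realfun ring lra zify.

Set Implicit Arguments.
Unset Strict Implicit.
Unset Printing Implicit Defensive.

Import Order.TTheory GRing.Theory Num.Theory.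
Import numFieldNormedType.Exports.

Local Open Scope classical_set_scope.
Local Open Scope ring_scope.

(** The sum in (b) is the sum over [n] of the length of the hull [U_n], the union
   of the dyadic arcs of generation [n] which meet [E] ([esum_dyadic_hull]). All
   three conditions are compared with it.

   Entropy. Each [U_n] contains [E], so that (b) forces [E] to have length zero.
   When this is the case, the length of [U_n] is the sum of those of its traces on
   the complementary arcs [I], and summing over [n] first shows that (b) depends
   on the sums over [n] of [arclength (U_n `&` I)]. If [2 ^- n] exceeds the length
   [l] of [I] then [U_n] contains [I], since a dyadic arc which meets [I] but not
   [E] lies in [I]; in general [I] meets at most two of the arcs making up [U_n],
   since a connected set avoiding both ends of a chord lies on one side of it
   ([card_meets_both]). The sum over [n] is therefore comparable to
   [l * ln l^-1], up to a multiple of [l] in one of the two inequalities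
   ([dyadic_entropy_le], [dyadic_entropy_ge]), and the lengths of the [I] have
   sum at most one. This is the equivalence of (a) and (b).

   From (b) to (c). If [P[mu](z(J)) >= C] then the Poisson kernel of [z(J)] is
   bounded below at some point of [E], so that [E] comes within a distance
   [O(sqrt |J|)] of [J]. Hence the ancestor of [J] at about half its generation,
   or one of the two neighbours of this ancestor, meets [E]
   ([poisson_ancestor]). In generation [n] the arcs [J] thus have total length at
   most three times that of [U_m] with [m] about [n / 2]; each [m] is used twice.
   The singularity of [mu] plays no role here.

   From (c) to (b). If (b) fails, then by repeated halving there is, in each
   generation [i], an arc [J_i] below which the sum still diverges
   ([below_diverges]). Distribute the mass [2 ^- i] below [J_i] by halving it at
   each step, except that the share of a half which misses [E] is put on a point
   of [E] in the parent; stop at a finite depth. The outcome is a finite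
   combination of point masses on [E] which gives to each arc [J] meeting [E]
   below [J_i], down to that depth, a mass at least [|J|]
   ([frostman_measure]), and such arcs satisfy [P[mu](z(J)) >= 3 / 68]
   ([poisson_ge]). If the depth is large enough that the lengths of these arcs
   have sum at least [i], the series of these measures is a finite singular
   measure which contradicts (c). *)

(** * The parametrization of the circle by the angle *)

Section trigonometry.
Variable R : realType.
Implicit Types s t b m : R.

Lemma expi_circle t : circle R (expi t).
Proof. exact: cos2Dsin2. Qed.

Lemma continuous_expi : continuous (@expi R).
Proof.
move=> t; apply: (@cvg_pair _ _ _ _ (nbhs (cos t)) (nbhs (sin t))).
  exact: continuous_cos.
exact: continuous_sin.
Qed.

Lemma circle_expi (z : R * R) : circle R z ->
  exists2 t, 0 <= t < 2 * pi & expi t = z.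
Proof.
case: z => x y /= z1; rewrite /circle /sqmod /= in z1.
have x1 : -1 <= x <= 1 by apply/andP; split; nra.
have sE : Num.sqrt (1 - x ^+ 2) = `|y| by rewrite -z1 addrC addKr sqrtr_sqr.
have := acos_ge0 x1; have := acos_lepi x1; have pi0 := pi_gt0 R.
move=> a1 a0; case: (leP 0 y) => y0.
  (* the arc cosine gives the upper half circle; the lower one is reached by
     reflection *)
  exists (acos x); first by apply/andP; split; lra.
  by rewrite /expi acosK ?in_itv//= sin_acos// sE ger0_norm.
have ax : acos x != 0.
  apply/eqP => a00; have := acosK; move/(_ R x); rewrite in_itv/= => /(_ x1).
  by rewrite a00 cos0 => x1'; move: z1; rewrite -x1'; nra.
exists (pi *+ 2 - acos x).
  have : 0 < acos x by rewrite lt_neqAle eq_sym ax.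
  by rewrite -mulr_natl => ?; apply/andP; split; lra.
have /= := cosD2pi (- acos x); have /= := sinD2pi (- acos x).
rewrite ![- acos x + _]addrC /expi => -> ->.
by rewrite cosN sinN acosK ?in_itv//= sin_acos// sE ltr0_norm// opprK.
Qed.

(** The squared chord between two points of the circle. *)
Lemma sqmod_expiB s t :
  sqmod (expi s - expi t) = 4 * sin ((s - t) / 2) ^+ 2.
Proof.
rewrite /sqmod /=.
have -> : 4 * sin ((s - t) / 2) ^+ 2 = 2 - 2 * cos (s - t).
  have {2}-> : s - t = ((s - t) / 2) *+ 2 by rewrite -mulr_natl; field.
  by rewrite cos_mulr2n sin2cos2 -mulr_natl; ring.
by rewrite cosB; have := cos2Dsin2 s; have := cos2Dsin2 t; lra.
Qed.

Lemma sin_half_gt0 t : 0 < t < 2 * pi -> 0 < sin (t / 2).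
Proof. by move=> /andP[t0 t1]; apply: sin_gt0_pi; apply/andP; split; lra. Qed.

Lemma expi_inj s t : 0 <= s < 2 * pi -> 0 <= t < 2 * pi ->
  expi s = expi t -> s = t.
Proof.
wlog st : s t / t <= s => [W|] s0 t0 est.
  by case: (leP t s) => [|/ltW] ts; [exact: W|apply/esym/W].
have := sqmod_expiB s t; rewrite est subrr /sqmod /= expr0n /= addr0.
move=> /esym/eqP; rewrite mulf_eq0 pnatr_eq0 /= expf_eq0 /= => /eqP sin0.
apply/eqP/negPn/negP => nst; have : 0 < sin ((s - t) / 2).
  by apply: sin_half_gt0; move/eqP in nst; apply/andP; split; lra.
by rewrite sin0 ltxx.
Qed.

Lemma sin_le_id t : 0 <= t -> sin t <= t.
Proof.
move=> t0; have [->|/eqP tn0] := eqVneq t 0; first by rewrite sin0.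
have tp : 0 < t by lra.
have [c _] := @MVT_segment R sin cos 0 t (ltW tp) (fun x _ => is_derive_sin x)
  (continuous_subspaceT (@continuous_sin R)).
rewrite sin0 !subr0 => ->; have := cos_le1 c; nra.
Qed.

Lemma sin_sqr_le t : sin t ^+ 2 <= t ^+ 2.
Proof.
rewrite -[leLHS]real_normK ?num_real// -[leRHS]real_normK ?num_real//.
rewrite ler_sqr ?nnegrE//; case: (leP 0 t) => t0.
  rewrite (ger0_norm t0) ler_norml sin_le_id// andbT.
  have [t1|t1] := leP t pi.
    by have := @sin_ge0_pi R t; rewrite t0 t1 => /(_ isT); lra.
  by have := sin_geN1 t; have := pi_ge2 R; lra.
rewrite (ltr0_norm t0) -normrN -sinN ler_norml sin_le_id ?andbT; last lra.
have [t1|t1] := leP (- t) pi.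
  by have := @sin_ge0_pi R (- t); rewrite t1 => H; have := H ltac:(lra); lra.
by have := sin_geN1 (- t); have := pi_ge2 R; lra.
Qed.

(** Doubling the angle at most doubles the sine; this is the inequality of
   Jordan at the dyadic fractions of [pi / 2]. *)
Lemma sin_dyadic_ge j : (2 ^+ j)^-1 <= sin (pi / 2 ^+ j.+1) :> R.
Proof.
elim: j => [|j IH]; first by rewrite expr0 expr1 invr1 sin_pihalf.
have pi0 := pi_gt0 R; have p2 : 0 < 2 ^+ j.+2 :> R by rewrite exprn_gt0.
have E : pi / 2 ^+ j.+1 = (pi / 2 ^+ j.+2) *+ 2 :> R.
  have q2 : 2 ^+ j.+1 != 0 :> R by rewrite gt_eqF// exprn_gt0.
  by rewrite [in RHS](exprS _ j.+1) -mulr_natl; field.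
have s0 : 0 <= sin (pi / 2 ^+ j.+2) :> R.
  apply: sin_ge0_pi; rewrite divr_ge0 ?pi_ge0 ?exprn_ge0//=.
  by rewrite ler_pdivrMr// ler_peMr ?pi_ge0// exprn_ege1// ler1n.
have := cos_le1 (pi / 2 ^+ j.+2 : R).
have S x : sin (x *+ 2) = 2 * (cos x * sin x) :> R.
  by rewrite sin_mulr2n [RHS]mulr_natl.
have H : (2 ^+ j)^-1 = 2 * (2 ^+ j.+1)^-1 :> R.
  by rewrite exprS invfM mulrA divff ?mul1r// pnatr_eq0.
move: IH s0; rewrite E S H.
move: (pi / _) ((2 ^+ j.+1)^-1) => x p; clear; nra.
Qed.

Lemma sin_lt_dyadic t j : 0 <= t <= pi / 2 -> sin t < (2 ^+ j)^-1 ->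
  t < pi / 2 ^+ j.+1.
Proof.
move=> /andP[t0 t1] st; rewrite ltNge; apply/negP => le.
have pi0 := pi_gt0 R; have p2 : 0 < 2 ^+ j.+1 :> R by rewrite exprn_gt0.
have pj0 : 0 < pi / 2 ^+ j.+1 :> R by rewrite divr_gt0.
have := sin_dyadic_ge j; apply/negP; rewrite -ltNge; apply: le_lt_trans st.
have [->//|/eqP nt] := eqVneq t (pi / 2 ^+ j.+1).
by apply/ltW; rewrite ltr_sin ?in_itv/=; lra.
Qed.

End trigonometry.

(** * Measurability in the plane, and length as a measure *)

Lemma negligible_bigcup_countable d (T : measurableType d) (R : realType)
    (mu : {measure set T -> \bar R}) (I : countType) (F : I -> set T) :
  (forall i, mu.-negligible (F i)) -> mu.-negligible (\bigcup_i F i).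
Proof.
move=> F0; pose G n := if unpickle n is Some i then F i else set0.
apply: (@negligibleS _ _ _ mu (\bigcup_n G n)).
  by move=> x [i _ Fx]; exists (pickle i) => //; rewrite /G pickleK.
apply: negligible_bigcup => n; rewrite /G; case: unpickle => [i|]; first exact: F0.
exact: negligible_set0.
Qed.

Section measure_copy.
Context d (T : measurableType d) (R : realType) (mu : {measure set T -> \bar R}).
Hypothesis mu_fin : fin_num_fun mu.

Let measure_copy : set T -> \bar R := mu.
HB.instance Definition _ := Measure.copy measure_copy mu.
HB.instance Definition _ := @Measure_isFinite.Build d T R measure_copy mu_fin.

Lemma fin_num_finite_measure :
  exists nu : {finite_measure set T -> \bar R}, forall A, nu A = mu A.
Proof. by exists measure_copy. Qed.

End measure_copy.

Lemma finite_measure_lty d (T : measurableType d) (R : realType)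
    (mu : {measure set T -> \bar R}) : (mu setT < +oo)%E ->
  exists nu : {finite_measure set T -> \bar R}, forall A, nu A = mu A.
Proof.
move=> muT; apply: fin_num_finite_measure => A mA; rewrite ge0_fin_numE//.
by apply: le_lt_trans muT; apply: le_measure; rewrite ?inE.
Qed.

Section plane_measurability.
Variable R : realType.
Implicit Types (U E : set (R * R)) (x : R * R).

(** The rectangles with rational corners: a countable base of the plane. *)
Definition rat_box (q : (rat * rat) * (rat * rat)) : set (R * R) :=
  `]ratr q.1.1, ratr q.1.2[ `*` `]ratr q.2.1, ratr q.2.2[.

Lemma measurable_rat_box q : measurable (rat_box q).
Proof. by apply: measurableX; exact: measurable_itv. Qed.

Lemma open_rat_box U x : open U -> U x ->
  exists q, rat_box q x /\ rat_box q `<=` U.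
Proof.
move=> oU Ux; have /nbhs_ballP[e /= e0 eU] : nbhs x U.
  by apply: open_nbhs_nbhs; split.
have rat_near (y : R) : exists q : rat * rat,
    ratr q.1 < y < ratr q.2 /\ (forall z : R, ratr q.1 < z < ratr q.2 -> `|y - z| < e).
  have [a] := @rat_in_itvoo R (y - e) y ltac:(lra).
  have [b] := @rat_in_itvoo R y (y + e) ltac:(lra).
  rewrite !in_itv /= => /andP[b1 b2] /andP[a1 a2]; exists (a, b) => /=.
  split; first by rewrite a2 b1.
  by move=> z /andP[za zb]; rewrite ltr_norml; lra.
have [a [a1 a2]] := rat_near x.1; have [b [b1 b2]] := rat_near x.2.
exists (a, b); split; first by split; rewrite /= in_itv.
move=> z [z1 z2]; apply: eU; split; rewrite /ball/=.
  by apply: a2; move: z1; rewrite /= in_itv.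
by apply: b2; move: z2; rewrite /= in_itv.
Qed.

Lemma open_plane_measurable U : open U -> measurable U.
Proof.
move=> oU; pose F q := if `[< rat_box q `<=` U >] then rat_box q else set0.
have -> : U = \bigcup_q F q.
  apply/seteqP; split=> [x Ux|x [q _]].
    have [q [qx qU]] := open_rat_box oU Ux.
    by exists q => //; rewrite /F asboolT.
  by rewrite /F; case: asboolP => // qU; exact: qU.
apply: countable_bigcupT_measurable => [|q]; first exact: countableP.
by rewrite /F; case: ifP => _; [exact: measurable_rat_box|exact: measurable0].
Qed.

Lemma closed_plane_measurable E : closed E -> measurable E.
Proof.
move=> cE; rewrite -[E]setCK; apply: measurableC.
by apply: open_plane_measurable; exact: closed_openC.
Qed.

Lemma measurable_finite_plane (F : set (R * R)) :
  finite_set F -> measurable F.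
Proof.
move=> finF; rewrite (_ : F = \bigcup_(x in F) [set x]); last first.
  by apply/seteqP; split=> [x Fx|x [_ Fy ->]] //; exists x.
apply: fin_bigcup_measurable => // x _; apply: closed_plane_measurable.
exact/accessible_closed_set1/hausdorff_accessible/norm_hausdorff.
Qed.

(** The plane being second countable, a measure does not charge the complement
   of its closed support. *)
Lemma measure_setC_support (mu : {measure set (R * R) -> \bar R}) E :
  closed_support mu `<=` E -> mu.-negligible (~` E).
Proof.
move=> muE.
pose F q := if mu (rat_box q) == 0%E then rat_box q else set0.
apply: (@negligibleS _ _ _ mu (\bigcup_q F q)); last first.
  apply: negligible_bigcup_countable => q; rewrite /F.
  case: eqP => [q0|_]; last exact: negligible_set0.
  by apply/negligibleP => //; exact: measurable_rat_box.
move=> x /= nEx.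
have : ~ closed_support mu x by move=> /muE.
rewrite /closed_support /= -existsNP => -[U].
move=> /not_implyP[oU] /not_implyP[Ux] /negP; rewrite -leNgt => muU.
have [q [qx qU]] := open_rat_box oU Ux.
exists q => //; rewrite /F.
suff -> : mu (rat_box q) == 0%E by [].
rewrite -measure_le0; apply: le_trans muU; apply: le_measure => //.
  by rewrite inE; exact: measurable_rat_box.
by rewrite inE; exact: open_plane_measurable.
Qed.

Lemma measurable_expi : measurable_fun [set: R] (@expi R).
Proof.
by apply/measurable_fun_pairP; split; apply: continuous_measurable_fun;
  [exact: continuous_cos|exact: continuous_sin].
Qed.

Lemma compact_expi (a b : R) : compact (@expi R @` `[a, b]).
Proof.
apply: continuous_compact; last exact: segment_compact.
exact/continuous_subspaceT/continuous_expi.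
Qed.

Lemma measurable_expi_itv (a b : R) : measurable (@expi R @` `[a, b]).
Proof.
apply: closed_plane_measurable; apply: compact_closed (@compact_expi a b).
exact: norm_hausdorff.
Qed.

Lemma measurable_expi_itvco (a b : R) : measurable (@expi R @` `[a, b[).
Proof.
rewrite itv_bnd_open_bigcup image_bigcup; apply: bigcup_measurable => n _.
exact: measurable_expi_itv.
Qed.

Lemma measurable_circle : measurable (circle R).
Proof.
have -> : circle R = @expi R @` `[0, 2 * pi[.
  apply/seteqP; split=> [z /circle_expi[t t0 <-]|_ [t _ <-]].
    by exists t => //=; rewrite in_itv.
  exact: expi_circle.
exact: measurable_expi_itvco.
Qed.

End plane_measurability.

Section arclength_measure.
Variable R : realType.
Local Open Scope ereal_scope.

Let scale_ge0 : (0 <= (2 * pi)^-1 :> R)%R.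
Proof. by rewrite invr_ge0 mulr_ge0// pi_ge0. Qed.

Let dom_measurable : @measurable _ (measurableTypeR R) `[0%R, (2 * pi)%R[.
Proof. exact: measurable_itv. Qed.

Let restricted_lebesgue : {measure set (measurableTypeR R) -> \bar R} :=
  mrestr (@lebesgue_measure R) dom_measurable.

Let expi_measurable :
  measurable_fun [set: measurableTypeR R] (@expi R : measurableTypeR R -> _).
Proof. exact: measurable_expi. Qed.

Let nu : {measure set (R * R) -> \bar R} := mscale (NngNum scale_ge0)
  (measure_function_pushforward__canonical__measure_function_Measure
    restricted_lebesgue expi_measurable).

Let arclengthE A : arclength A = nu A.
Proof. by rewrite /arclength setIC. Qed.

Let arclength0 : arclength set0 = 0 :> \bar R.
Proof. by rewrite arclengthE measure0. Qed.

Let arclength_ge0 A : 0 <= @arclength R A.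
Proof. by rewrite arclengthE. Qed.

Let arclength_sigma_additive : semi_sigma_additive (@arclength R).
Proof.
rewrite (_ : @arclength R = nu); last by apply/funext => A; exact: arclengthE.
exact: measure_semi_sigma_additive.
Qed.

(** Normalized length is a Borel measure on the plane, carried by the circle:
   the image of a multiple of Lebesgue measure on [[0, 2 pi[]. *)
HB.instance Definition _ := isMeasure.Build _ _ _ (@arclength R)
  arclength0 arclength_ge0 arclength_sigma_additive.

End arclength_measure.

(** * Dyadic arcs *)

Section dyadic_arcs.
Variable R : realType.
Implicit Types (n k l d : nat) (t : R) (z : R * R).
Local Notation ang := (dyadic_angle R).
Local Notation arc := (dyadic_arc R).

Lemma pow2_gt0 n : 0 < 2 ^+ n :> R. Proof. by rewrite exprn_gt0. Qed.

Lemma inv_pow2_itv n : 0 < (2 ^+ n : R)^-1 <= 1.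
Proof. by rewrite invr_gt0 pow2_gt0/= invf_le1 ?pow2_gt0// exprn_ege1// ler1n. Qed.

Lemma twopi_gt0 : 0 < 2 * pi :> R. Proof. by rewrite mulr_gt0// pi_gt0. Qed.

Lemma dyadic_angle_lt n k l : (ang n k < ang n l) = (k < l)%N.
Proof.
by rewrite /dyadic_angle ltr_pM2r ?invr_gt0 ?pow2_gt0// ltr_pM2l ?twopi_gt0// ltr_nat.
Qed.

Lemma dyadic_angle_le n k l : (ang n k <= ang n l) = (k <= l)%N.
Proof. by rewrite !leNgt dyadic_angle_lt -leqNgt. Qed.

Lemma dyadic_angle0 n : ang n 0 = 0.
Proof. by rewrite /dyadic_angle mulr0 mul0r. Qed.

Lemma dyadic_angle_refine n d k : ang (n + d) (k * 2 ^ d) = ang n k.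
Proof.
rewrite /dyadic_angle natrM natrX exprD; field.
by rewrite !gt_eqF// pow2_gt0.
Qed.

Lemma dyadic_angle_full n : ang n (2 ^ n) = 2 * pi.
Proof.
rewrite -[(2 ^ n)%N]mul1n -{1}[n]add0n dyadic_angle_refine.
by rewrite /dyadic_angle expr0 mulr1 divr1.
Qed.

Lemma dyadic_angle_width n k : ang n k.+1 = ang n k + 2 * pi / 2 ^+ n.
Proof. by rewrite /dyadic_angle -[in LHS]natr1; field; rewrite gt_eqF// pow2_gt0. Qed.

Lemma dyadic_angle_dom n k t : (k < 2 ^ n)%N -> ang n k <= t < ang n k.+1 ->
  0 <= t < 2 * pi.
Proof.
move=> kn /andP[t1 t2]; rewrite -(dyadic_angle0 n) -(dyadic_angle_full n).
by rewrite (le_trans _ t1) ?dyadic_angle_le//= (lt_le_trans t2)// dyadic_angle_le.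
Qed.

Lemma dyadic_arcP n k t : (k < 2 ^ n)%N -> 0 <= t < 2 * pi ->
  arc (n, k) (expi t) <-> ang n k <= t < ang n k.+1.
Proof.
move=> kn t0; split=> [[s]|tk]; rewrite /=; last by exists t; rewrite //= in_itv.
rewrite in_itv /= => sk /expi_inj <-//; exact: dyadic_angle_dom sk.
Qed.

Lemma dyadic_arc_circle p : arc p `<=` circle R.
Proof. by move=> _ [t _ <-]; exact: expi_circle. Qed.

Lemma dyadic_angle_index n t : 0 <= t < 2 * pi ->
  exists2 k, (k < 2 ^ n)%N & ang n k <= t < ang n k.+1.
Proof.
move=> /andP[t0 t1]; have tp := twopi_gt0; have p2 := pow2_gt0 n.
have x0 : 0 <= t / (2 * pi) * 2 ^+ n by rewrite !mulr_ge0 ?invr_ge0// ltW.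
have /andP[k1 k2] := truncn_itv x0; set k := Num.trunc _ in k1 k2.
have tE : t = 2 * pi * (t / (2 * pi) * 2 ^+ n) / 2 ^+ n.
  by rewrite mulrA mulfK ?gt_eqF// mulrC divfK ?gt_eqF.
have tk : ang n k <= t < ang n k.+1.
  rewrite tE /dyadic_angle ler_pM2r ?invr_gt0// ltr_pM2r ?invr_gt0//.
  by rewrite ler_pM2l// ltr_pM2l// k1.
exists k => //; rewrite -(dyadic_angle_lt n) dyadic_angle_full.
by move/andP: tk => [/le_lt_trans + _]; apply.
Qed.

Lemma dyadic_arc_cover n z : circle R z -> exists2 k, (k < 2 ^ n)%N & arc (n, k) z.
Proof.
move=> /circle_expi[t t0 <-]; have [k kn tk] := dyadic_angle_index n t0.
by exists k => //; apply/dyadic_arcP.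
Qed.

Lemma dyadic_arc_inj n k l z : (k < 2 ^ n)%N -> (l < 2 ^ n)%N ->
  arc (n, k) z -> arc (n, l) z -> k = l.
Proof.
move=> kn ln /[dup] /dyadic_arc_circle /circle_expi[t t0 <-].
move=> /(dyadic_arcP kn t0)/andP[k1 k2] /(dyadic_arcP ln t0)/andP[l1 l2].
have := le_lt_trans k1 l2; have := le_lt_trans l1 k2.
by rewrite !dyadic_angle_lt !ltnS => lk kl; apply/eqP; rewrite eqn_leq kl lk.
Qed.

Lemma measurable_dyadic_arc p : measurable (arc p).
Proof. exact: measurable_expi_itvco. Qed.

Lemma connected_dyadic_arc p : connected (arc p).
Proof.
apply: connected_continuous_connected.
  by apply/connected_intervalP; exact: interval_is_interval.
exact/continuous_subspaceT/continuous_expi.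
Qed.

Lemma arclength_dyadic_arc n k : (k < 2 ^ n)%N ->
  arclength (arc (n, k)) = ((2 ^+ n)^-1)%:E.
Proof.
move=> kn; rewrite /arclength.
have -> : `[0, 2 * pi[ `&` @expi R @^-1` arc (n, k) =
    `[ang n k, ang n k.+1[%classic.
  apply/seteqP; split=> t /=; rewrite !in_itv /=.
    by move=> [t0 /(dyadic_arcP kn t0)].
  by move=> tk; have t0 := dyadic_angle_dom kn tk; split=> //; apply/dyadic_arcP.
rewrite lebesgue_measure_itv /= lte_fin dyadic_angle_lt ltnSn -EFinD -EFinM.
rewrite dyadic_angle_width addrC addKr; congr EFin.
by rewrite mulrA mulVf ?mul1r// gt_eqF// twopi_gt0.
Qed.

(** The arcs of one generation refine those of the preceding ones. *)
Lemma dyadic_arc_sub n d k : arc (n + d, k)%N `<=` arc (n, (k %/ 2 ^ d)%N).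
Proof.
move=> _ [t tk <-]; exists t => //; move: tk; rewrite /= !in_itv /=.
have p2 : (0 < 2 ^ d)%N by rewrite expn_gt0.
rewrite -(dyadic_angle_refine n d) -(dyadic_angle_refine n d _.+1).
move=> /andP[t1 t2]; apply/andP; split.
  by apply: le_trans t1; rewrite dyadic_angle_le leq_trunc_div.
by apply: lt_le_trans t2 _; rewrite dyadic_angle_le ltn_ceil.
Qed.

(** Every neighbourhood of a point of the circle contains a dyadic arc through
   this point. *)
Lemma dyadic_arc_basis (U : set (R * R)) z : open U -> U z -> circle R z ->
  exists2 p, dyadic_index p & arc p z /\ arc p `<=` U.
Proof.
move=> oU Uz /circle_expi[t t0 tz]; subst z.
have /nbhs_ballP[e /= e0 eU] : nbhs t (@expi R @^-1` U).
  by apply: (@continuous_expi R t); apply: open_nbhs_nbhs; split.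
pose n := Num.trunc (2 * pi / e).
have en : 2 * pi / 2 ^+ n < e.
  have p0 : 0 <= 2 * pi / e by rewrite divr_ge0// ltW// twopi_gt0.
  have /andP[_] := truncn_itv p0; rewrite -/n ltr_pdivrMr// => h.
  rewrite ltr_pdivrMr ?pow2_gt0//; apply: lt_le_trans h _.
  by rewrite mulrC ler_pM2l// -natrX ler_nat ltn_expl.
have [k kn tk] := dyadic_angle_index n t0.
exists (n, k) => //; split; first by apply/dyadic_arcP.
move=> _ [s + <-]; rewrite /= in_itv /= => sk; apply: eU.
move: sk tk en; rewrite dyadic_angle_width /ball /= ltr_norml; lra.
Qed.

Lemma arclength_circle : arclength (circle R) = 1%E.
Proof.
rewrite /arclength (_ : _ `&` _ = `[0, 2 * pi[)%classic; last first.
  by apply/seteqP; split=> [t []//|t t0]; split=> //; exact: expi_circle.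
rewrite lebesgue_measure_itv /= lte_fin twopi_gt0 -EFinD -EFinM subr0.
by rewrite mulVf// gt_eqF// twopi_gt0.
Qed.

Lemma arclength_le1 (A : set (R * R)) : measurable A -> A `<=` circle R ->
  (arclength A <= 1)%E.
Proof.
move=> mA Ac; rewrite -arclength_circle; apply: le_measure => //; rewrite inE//.
exact: measurable_circle.
Qed.

Lemma arclength_fin_num (A : set (R * R)) : measurable A -> A `<=` circle R ->
  arclength A \is a fin_num.
Proof.
by move=> mA Ac; rewrite ge0_fin_numE// (le_lt_trans (arclength_le1 mA Ac)) ?ltry.
Qed.

Lemma arclength_countable (N : set (R * R)) : countable N -> arclength N = 0%E.
Proof.
move=> /countable_injP[f finj]; rewrite /arclength countable_lebesgue_measure0 ?mule0//.
apply/countable_injP; exists (f \o @expi R) => s t.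
rewrite !inE /= !in_itv /= => -[s0 Ns] [t0 Nt] /finj; rewrite !inE => st.
exact: expi_inj (st Ns Nt).
Qed.

End dyadic_arcs.

(** * Sums over dyadic arcs *)

Section counting.
Variable R : realType.

Lemma esum_finset (T : finType) (V : {set T}) (f : T -> \bar R) :
  (forall i, 0 <= f i)%E ->
  \esum_(i in [set` V]) f i = (\sum_(i in V) f i)%E.
Proof.
move=> f0; rewrite esum_fset//.
by rewrite [RHS]bigfs ?index_enum_uniq// => i _; rewrite mem_index_enum.
Qed.

Lemma nneseries_lt_pinfty (f : nat -> R) : (forall n, 0 <= f n) ->
  (\sum_(n <oo) (f n)%:E < +oo)%E <->
  exists B, forall N, \sum_(n < N) f n <= B.
Proof.
move=> f0; have f0' n : (0 <= (f n)%:E)%E by rewrite lee_fin.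
split=> [fy|[B fB]].
  exists (fine (\sum_(n <oo) (f n)%:E)%E) => N.
  rewrite -lee_fin fineK; last by rewrite ge0_fin_numE// nneseries_ge0.
  rewrite -sumEFin -(big_mkord xpredT (fun i => (f i)%:E)).
  exact: nneseries_lim_ge.
apply: (@le_lt_trans _ _ B%:E); last exact: ltry.
apply: lime_le; first exact: is_cvg_nneseries.
by apply: nearW => N /=; rewrite big_mkord sumEFin lee_fin.
Qed.

(** The union of the dyadic arcs of generation [n] with indices in [V]. *)
Definition dyadic_union n (V : {set 'I_(2 ^ n)}) : set (R * R) :=
  \bigcup_(k in [set` V]) dyadic_arc R (n, val k).

Lemma measurable_dyadic_union n (V : {set 'I_(2 ^ n)}) :
  measurable (dyadic_union V).
Proof.
apply: fin_bigcup_measurable => [|k _]; first exact: finite_finset.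
exact: measurable_dyadic_arc.
Qed.

Lemma dyadic_union_circle n (V : {set 'I_(2 ^ n)}) :
  dyadic_union V `<=` circle R.
Proof. by move=> z [k _]; exact: dyadic_arc_circle. Qed.

Lemma arclength_dyadic_union n (V : {set 'I_(2 ^ n)}) :
  arclength (dyadic_union V) = (#|V|%:R / 2 ^+ n)%:E.
Proof.
rewrite measure_fin_bigcup; last 3 first.
- exact: finite_finset.
- move=> k l _ _ [z [kz lz]]; apply: val_inj.
  exact: dyadic_arc_inj (ltn_ord k) (ltn_ord l) kz lz.
- by move=> k _; exact: measurable_dyadic_arc.
rewrite -esum_fset//.
rewrite esum_finset// (eq_bigr (fun=> ((2 ^+ n)^-1)%:E)) => [|k _].
  by rewrite sumEFin sumr_const mulr_natl.
exact: (arclength_dyadic_arc R (ltn_ord k)).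
Qed.

(** The indices of the dyadic arcs of generation [n] satisfying [K]. *)
Definition generation (K : nat * nat -> Prop) n : {set 'I_(2 ^ n)} :=
  finset (fun k : 'I_(2 ^ n) => `[< K (n, val k) >]).

Lemma in_generation (K : nat * nat -> Prop) n (k : 'I_(2 ^ n)) :
  (k \in generation K n) = `[< K (n, val k) >].
Proof. by rewrite inE. Qed.

Lemma esum_generation (K : nat * nat -> Prop) :
  \esum_(p in [set p | dyadic_index p /\ K p]) arclength (dyadic_arc R p) =
  (\sum_(n <oo) (#|generation K n|%:R / 2 ^+ n)%:E)%E.
Proof.
pose J n := [set k | (k < 2 ^ n)%N /\ K (n, k)].
have -> : [set p | dyadic_index p /\ K p] = [set: nat] `*`` J.
  by apply/seteqP; split=> [[n k] []|[n k] [_ []]].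
rewrite -(esum_esum (a := fun n k => arclength (dyadic_arc R (n, k))))//.
rewrite nneseries_esumT => [|n]; last by rewrite lee_fin divr_ge0// exprn_ge0.
apply: eq_esum => n _.
have -> : J n = [set val k | k in [set` generation K n]].
  apply/seteqP; split=> [k [kn Kk]|_ [k + <-]] /=.
    by exists (Ordinal kn) => //=; rewrite in_generation; apply/asboolP.
  by rewrite /= in_generation => /asboolP; split=> //; exact: ltn_ord.
rewrite esum_image => [|k l _ _]; last exact: val_inj.
rewrite esum_finset// -arclength_dyadic_union.
rewrite measure_fin_bigcup; last 3 first.
- exact: finite_finset.
- move=> k l _ _ [z [kz lz]]; apply: val_inj.
  exact: dyadic_arc_inj (ltn_ord k) (ltn_ord l) kz lz.
- by move=> k _; exact: measurable_dyadic_arc.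
rewrite -esum_fset//.
by rewrite esum_finset.
Qed.

Lemma generation_ratio_ge0 (K : nat * nat -> Prop) n :
  0 <= #|generation K n|%:R / 2 ^+ n :> R.
Proof. by rewrite divr_ge0// exprn_ge0. Qed.

Lemma generation_ratio_le1 (K : nat * nat -> Prop) n :
  #|generation K n|%:R / 2 ^+ n <= 1 :> R.
Proof.
rewrite ler_pdivrMr ?pow2_gt0// mul1r -natrX ler_nat.
by rewrite -[leqRHS]card_ord max_card.
Qed.

End counting.
Arguments dyadic_union R {n} V.

(** * Sums over arbitrary families *)

Section infinite_sums.
Variable R : realType.
Local Open Scope ereal_scope.

Lemma esum_setU_le (T : choiceType) (A B : set T) (a : T -> \bar R) :
  (forall i, 0 <= a i) ->
  \esum_(i in A `|` B) a i <= \esum_(i in A) a i + \esum_(i in B) a i.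
Proof.
move=> a0; rewrite !(esum_mkcond _ a) -esumD; last 2 first.
- by move=> i _; case: ifP.
- by move=> i _; case: ifP.
apply: le_esum => i _; rewrite in_setU.
by case: (i \in A); case: (i \in B); rewrite /= ?adde0 ?add0e// leeDl.
Qed.

Lemma sub_esum (T : choiceType) (A B : set T) (a : T -> \bar R) : A `<=` B ->
  \esum_(i in A) a i <= \esum_(i in B) a i.
Proof.
move=> AB; apply: ge_ereal_sup => _ [X [finX XA] <-]; apply: esum_ge.
by exists X => //; split=> // i /XA /AB.
Qed.

Lemma exchange_esum (S T : choiceType) (A : set S) (B : set T)
    (a : S -> T -> \bar R) : (forall i j, 0 <= a i j) ->
  \esum_(i in A) \esum_(j in B) a i j = \esum_(j in B) \esum_(i in A) a i j.
Proof.
move=> a0; rewrite esum_esum// [RHS](esum_esum (a := fun j i => a i j))//.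
rewrite (reindex_esum (B `*` A) (A `*` B) (fun x => (x.2, x.1)))//; split=> //=.
- by move=> [i j] [].
- by move=> [i j] [k l] _ _ [-> ->].
- by move=> [i j] [/= Ai Bj]; exists (j, i).
Qed.

Lemma esumM_le (T : choiceType) (A : set T) (a : T -> \bar R) (c : R) :
  (0 <= c)%R -> (forall i, A i -> 0 <= a i) ->
  \esum_(i in A) (c%:E * a i) <= c%:E * \esum_(i in A) a i.
Proof.
move=> c0 a0; apply: ge_ereal_sup => _ [X [finX XA] <-].
have -> : \sum_(i \in X) c%:E * a i = c%:E * \sum_(i \in X) a i.
  rewrite !fsbig_finite//= big_seq [in RHS]big_seq ge0_sume_distrr// => i.
  by rewrite in_fset_set// inE => /XA /a0.
by rewrite lee_wpmul2l ?lee_fin//; apply: esum_ge; exists X.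
Qed.

(** Countable subadditivity, for a family indexed by any countable set. *)
Lemma measure_bigcup_esum d (T : measurableType d) (I : choiceType)
    (mu : {measure set T -> \bar R}) (D : set I) (F : I -> set T) :
  countable D -> (forall i, D i -> measurable (F i)) ->
  mu (\bigcup_(i in D) F i) <= \esum_(i in D) mu (F i).
Proof.
move=> /countable_injP[f finj] mF.
pose G n := \bigcup_(i in D `&` f @^-1` [set n]) F i.
have GF i : D i -> G (f i) = F i.
  move=> Di; apply/seteqP; split=> [x [j [Dj /= /finj ->]]|x Fx]; rewrite ?inE//.
  by exists i.
have mG n : measurable (G n).
  have [[i [Di <-]]|nD] := pselect (exists i, D i /\ f i = n).
    by rewrite GF//; exact: mF.
  rewrite (_ : G n = set0)// -subset0 => x [i [Di /= fi] _].
  by apply: nD; exists i.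
have -> : \bigcup_(i in D) F i = \bigcup_n G n.
  apply/seteqP; split=> [x [i Di Fx]|x [n _ [i [Di _] Fx]]]; last by exists i.
  by exists (f i) => //; exists i.
apply: (@le_trans _ _ (\sum_(n <oo) mu (G n))).
  by apply: measure_sigma_subadditive => //; exact: bigcup_measurable.
rewrite nneseries_esumT// (esumID (f @` D))//.
rewrite [X in _ + X]esum1 ?adde0 => [|n [_ /= nD]]; last first.
  rewrite (_ : G n = set0) ?measure0// -subset0 => x [i [Di /= fi] _].
  by apply: nD; exists i.
rewrite setTI esum_image => [|i j /set_mem Di /set_mem Dj]; last first.
  by apply: finj; rewrite inE.
by apply: le_esum => i Di; rewrite GF.
Qed.

End infinite_sums.


(** * Connected sets and dyadic arcs *)

Section chords.
Variable R : realType.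
Implicit Types (I E : set (R * R)).

Lemma sin_half_lt0 (t : R) : - (2 * pi) < t < 0 -> sin (t / 2) < 0.
Proof.
move=> /andP[t1 t2]; rewrite -oppr_gt0 -sinN -mulNr; apply: sin_half_gt0.
by apply/andP; split; lra.
Qed.

(** A connected subset of the circle which avoids both ends of a chord lies on
   one side of it. *)
Lemma connected_chord I (a b s t : R) : connected I -> I `<=` circle R ->
  ~ I (expi a) -> ~ I (expi b) -> 0 <= a -> b < 2 * pi ->
  0 <= t < 2 * pi -> I (expi s) -> I (expi t) -> a < s < b -> a < t < b.
Proof.
move=> cI Ic Ia Ib a0 b0 t0 Is It /andP[as_ sb].
(* an affine function of the point, vanishing on the chord; its values on [I]
   form an interval *)
pose L (z : R * R) := z.1 * cos ((a + b) / 2) + z.2 * sin ((a + b) / 2)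
  - cos ((b - a) / 2).
have LE u : L (expi u) = 2 * (sin ((u - a) / 2) * sin ((b - u) / 2)).
  have -> : L (expi u) = cos (u - (a + b) / 2) - cos ((b - a) / 2).
    by rewrite cosB.
  have -> : u - (a + b) / 2 = (u - a) / 2 - (b - u) / 2 by field.
  have -> : (b - a) / 2 = (u - a) / 2 + (b - u) / 2 by field.
  by rewrite cosB cosD; ring.
have cL : continuous L.
  move=> z; rewrite /L; apply: cvgB; last exact: cvg_cst.
  apply: cvgD; apply: cvgM; try exact: cvg_cst.
    exact: cvg_fst.
  exact: cvg_snd.
have iL : is_interval (L @` I).
  apply/connected_intervalP; apply: connected_continuous_connected => //.
  exact: continuous_subspaceT.
have Ls : 0 < L (expi s).
  by rewrite LE !mulr_gt0//; apply: sin_half_gt0; apply/andP; split; lra.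
apply: contrapT => /negP; rewrite negb_and -!leNgt => tab.
have /andP[t1 t2] := t0.
have Lt : L (expi t) < 0.
  have [ta|ta] : t < a \/ b < t.
    case/orP: tab => h.
      by left; rewrite lt_neqAle h andbT; apply/eqP => ta; rewrite ta in It.
    by right; rewrite lt_neqAle h andbT; apply/eqP => tb; rewrite -tb in It.
  - rewrite LE pmulr_rlt0// nmulr_rlt0.
      by apply: sin_half_gt0; apply/andP; split; lra.
    by apply: sin_half_lt0; apply/andP; split; lra.
  - rewrite LE pmulr_rlt0// pmulr_rlt0.
      by apply: sin_half_lt0; apply/andP; split; lra.
    by apply: sin_half_gt0; apply/andP; split; lra.
have [z Iz] : (L @` I) 0.
  apply: (iL (L (expi t)) (L (expi s))); try by eexists; [|reflexivity].
  by rewrite (ltW Lt) (ltW Ls).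
have [u /andP[u1 u2] uz] := circle_expi (Ic _ Iz); rewrite -uz LE => /eqP.
rewrite !mulf_eq0 pnatr_eq0 /= => /orP[] /eqP s0.
  have [ua|ua|ua] := ltgtP u a; last by apply: Ia; rewrite -ua uz.
    have := @sin_half_lt0 (u - a); rewrite s0 ltxx => H.
    by have := H ltac:(lra).
  have := @sin_half_gt0 R (u - a); rewrite s0 ltxx => H.
  by have := H ltac:(lra).
have [ua|ua|ua] := ltgtP u b; last by apply: Ib; rewrite -ua uz.
  have := @sin_half_gt0 R (b - u); rewrite s0 ltxx => H.
  by have := H ltac:(lra).
have := @sin_half_lt0 (b - u); rewrite s0 ltxx => H.
by have := H ltac:(lra).
Qed.

(** At most two dyadic arcs of a given generation meet both [E] and a connected
   part of its complement. *)
Lemma card_meets_both E I n : connected I -> I `<=` circle R `\` E ->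
  E `<=` circle R ->
  (#|generation (fun p => dyadic_arc R p `&` E !=set0 /\
                          dyadic_arc R p `&` I !=set0) n| <= 2)%N.
Proof.
move=> cI IE Ec; set K := (fun p : nat * nat => _).
have Ic : I `<=` circle R by move=> z /IE[].
have nIE z : E z -> ~ I z by move=> Ez /IE[].
(* The second arc contains a point [s2] of [I] and a point [b2] of [E]. If [s2]
   comes first, [I] lies between [b1] and [b2] and misses the third arc; otherwise
   it lies between [b2] and [b3] and misses the first one. *)
have absurd3 k1 k2 k3 : (k1 < k2 < k3)%N -> (k1 < 2 ^ n)%N -> (k2 < 2 ^ n)%N ->
    (k3 < 2 ^ n)%N -> K (n, k1) -> K (n, k2) -> K (n, k3) -> False.
  move=> /andP[k12 k23] kn1 kn2 kn3.
  have angles k : (k < 2 ^ n)%N -> K (n, k) -> exists b s : R,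
      [/\ dyadic_angle R n k <= b < dyadic_angle R n k.+1,
          dyadic_angle R n k <= s < dyadic_angle R n k.+1,
          0 <= b < 2 * pi, 0 <= s < 2 * pi & E (expi b) /\ I (expi s)].
    move=> kn [[_ [[b bk <-] Eb]] [_ [[s sk <-] Is]]]; exists b, s.
    move: bk sk; rewrite /= !in_itv /= => bk sk.
    by split=> //; [exact: dyadic_angle_dom bk|exact: dyadic_angle_dom sk].
  move=> /(angles _ kn1)[b1 [s1 [bk1 sk1 bd1 sd1 [Eb1 Is1]]]].
  move=> /(angles _ kn2)[b2 [s2 [bk2 sk2 bd2 sd2 [Eb2 Is2]]]].
  move=> /(angles _ kn3)[b3 [s3 [bk3 sk3 bd3 sd3 [Eb3 Is3]]]].
  move: k12 k23; rewrite -!(dyadic_angle_le R n) => a12 a23.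
  have [sb|sb|sb] := ltgtP s2 b2; last by apply: (nIE _ Eb2); rewrite -sb.
    have := connected_chord cI Ic (nIE _ Eb1) (nIE _ Eb2) _ _ sd3 Is2 Is3.
    lra.
  have := connected_chord cI Ic (nIE _ Eb2) (nIE _ Eb3) _ _ sd1 Is2 Is1.
  lra.
rewrite leqNgt; apply/negP => /card_gt2P[k1 [k2 [k3 []]]].
rewrite !in_generation => -[/asboolP K1 /asboolP K2 /asboolP K3].
rewrite -!val_eqE /= => -[k12 k23 k31].
have := ltn_ord k1; have := ltn_ord k2; have := ltn_ord k3 => n3 n2 n1.
case: (ltngtP k1 k2) k12 => // k12 _; case: (ltngtP k2 k3) k23 => // k23 _;
  case: (ltngtP k3 k1) k31 => // k31 _; try lia.
- by apply: (absurd3 k1 k2 k3); rewrite ?k12 ?k23.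
- by apply: (absurd3 k3 k1 k2); rewrite ?k12 ?k31.
- by apply: (absurd3 k1 k3 k2); rewrite ?k31 ?k23.
- by apply: (absurd3 k2 k3 k1); rewrite ?k31 ?k23.
- by apply: (absurd3 k2 k1 k3); rewrite ?k31 ?k12.
- by apply: (absurd3 k3 k2 k1); rewrite ?k12 ?k23.
Qed.

End chords.

(** * Complementary arcs *)

Section complementary_arcs.
Variables (R : realType) (E : set (R * R)).
Hypotheses (E_circle : E `<=` circle R) (E_closed : closed E).
Implicit Types (I : set (R * R)) (n : nat).

(** The dyadic arc with index [p] meets [E]. *)
Definition meets (p : nat * nat) : Prop := dyadic_arc R p `&` E !=set0.

(** The union of the dyadic arcs of generation [n] which meet [E]. *)
Definition dyadic_hull n : set (R * R) := dyadic_union R (generation meets n).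

Lemma measurable_dyadic_hull n : measurable (dyadic_hull n).
Proof. exact: measurable_dyadic_union. Qed.

Lemma sub_dyadic_hull n : E `<=` dyadic_hull n.
Proof.
move=> z Ez; have [k kn kz] := dyadic_arc_cover n (E_circle Ez).
exists (Ordinal kn) => //=; rewrite in_generation; apply/asboolP.
by exists z.
Qed.

Lemma complementary_arcs_sub I : complementary_arcs E I -> I `<=` circle R `\` E.
Proof. by move=> [x _ <-]; exact: connected_component_sub. Qed.

Lemma complementary_arcs_connected I : complementary_arcs E I -> connected I.
Proof. by move=> [x _ <-]; exact: component_connected. Qed.

Lemma complementary_arcs_max I (A : set (R * R)) : complementary_arcs E I ->
  connected A -> A `<=` circle R `\` E -> A `&` I !=set0 -> A `<=` I.
Proof.
move=> [x _ <-] cA AE [z [Az /same_connected_component ->]].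
exact: connected_component_max.
Qed.

Lemma trivIset_complementary_arcs : trivIset (complementary_arcs E) id.
Proof.
move=> I J CI CJ IJ; apply/seteqP; split.
  apply: complementary_arcs_max CJ _ _ IJ; last exact: complementary_arcs_sub.
  exact: complementary_arcs_connected.
apply: complementary_arcs_max CI _ _ _; last by rewrite setIC.
  exact: complementary_arcs_connected.
exact: complementary_arcs_sub.
Qed.

Lemma bigcup_complementary_arcs :
  \bigcup_(I in complementary_arcs E) I = circle R `\` E.
Proof. exact: connected_component_cover. Qed.

(** A dyadic arc which meets [I] but not [E] is contained in [I]. *)
Lemma dyadic_arc_complementary I p : complementary_arcs E I ->
  dyadic_arc R p `&` I !=set0 -> ~ meets p -> dyadic_arc R p `<=` I.
Proof.
move=> CI pI npE; apply: complementary_arcs_max => //.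
  exact: connected_dyadic_arc.
move=> z pz; split; first exact: dyadic_arc_circle pz.
by move=> Ez; apply: npE; exists z.
Qed.

Lemma complementary_arcs_basis I z : complementary_arcs E I -> I z ->
  exists2 p, dyadic_index p & dyadic_arc R p z /\ dyadic_arc R p `<=` I.
Proof.
move=> CI Iz; have [cz nEz] := complementary_arcs_sub CI Iz.
have [p pd [pz pE]] := dyadic_arc_basis (closed_openC E_closed) nEz cz.
exists p => //; split=> //; apply: dyadic_arc_complementary => //.
  by exists z.
by move=> [x [/pE]].
Qed.

Lemma measurable_complementary_arcs I : complementary_arcs E I -> measurable I.
Proof.
move=> CI; pose F p := if `[< dyadic_arc R p `<=` I >] then dyadic_arc R p else set0.
have -> : I = \bigcup_p F p.
  apply/seteqP; split=> [x Ix|x [p _]].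
    have [p _ [px pI]] := complementary_arcs_basis CI Ix.
    by exists p => //; rewrite /F asboolT.
  by rewrite /F; case: asboolP => // pI; exact: pI.
apply: countable_bigcupT_measurable => [|p]; first exact: countableP.
by rewrite /F; case: ifP => _; [exact: measurable_dyadic_arc|exact: measurable0].
Qed.

Lemma complementary_arcs_dyadic I : complementary_arcs E I ->
  exists2 p, dyadic_index p & dyadic_arc R p `<=` I.
Proof.
move=> CI; have [x cx xI] := CI.
have [|p pd [_ pI]] := @complementary_arcs_basis I x CI.
  by rewrite -xI; exact: connected_component_refl.
by exists p.
Qed.

Lemma dyadic_arc_neq0 n k : dyadic_arc R (n, k) !=set0.
Proof.
exists (expi (dyadic_angle R n k)); exists (dyadic_angle R n k) => //.
by rewrite /= in_itv /= lexx /= dyadic_angle_lt ltnSn.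
Qed.

Lemma countable_complementary_arcs : countable (complementary_arcs E).
Proof.
have /boolp.choice[f fP] I : exists p : nat * nat,
    complementary_arcs E I -> dyadic_arc R p `<=` I.
  have [CI|nCI] := pselect (complementary_arcs E I).
    by have [p _ pI] := complementary_arcs_dyadic CI; exists p.
  by exists (0, 0)%N.
apply/countable_injP; exists (pickle \o f) => I J.
rewrite !inE => CI CJ /= /(pcan_inj (@pickleK _)) fIJ.
apply: trivIset_complementary_arcs => //.
have [z] := dyadic_arc_neq0 (f I).1 (f I).2; rewrite -surjective_pairing => fz.
by exists z; split; [exact: fP CI _ fz|apply: (fP J) => //; rewrite -fIJ].
Qed.

Lemma complementary_arcs_circle I : complementary_arcs E I -> I `<=` circle R.
Proof. by move=> /complementary_arcs_sub IE z /IE[]. Qed.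

Lemma arclength_complementary_fin_num I : complementary_arcs E I ->
  arclength I \is a fin_num.
Proof.
move=> CI; apply: arclength_fin_num; first exact: measurable_complementary_arcs.
exact: complementary_arcs_circle.
Qed.

Lemma arclength_complementary_itv I : complementary_arcs E I ->
  0 < fine (arclength I) <= 1.
Proof.
move=> CI; have fI := arclength_complementary_fin_num CI.
rewrite -lte_fin -(lee_fin _ 1) fineK//; apply/andP; split; last first.
  apply: arclength_le1; first exact: measurable_complementary_arcs.
  exact: complementary_arcs_circle.
have [[n k] kn pI] := complementary_arcs_dyadic CI.
apply: (@lt_le_trans _ _ (arclength (dyadic_arc R (n, k)))).
  by rewrite arclength_dyadic_arc// lte_fin invr_gt0 pow2_gt0.
apply: le_measure => //; rewrite inE; first exact: measurable_dyadic_arc.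
exact: measurable_complementary_arcs.
Qed.

Lemma arclength_hull_complementary_fin_num I n : complementary_arcs E I ->
  arclength (dyadic_hull n `&` I) \is a fin_num.
Proof.
move=> CI; apply: arclength_fin_num; last first.
  by move=> z [_]; exact: complementary_arcs_circle.
apply: measurableI; [exact: measurable_dyadic_hull|].
exact: measurable_complementary_arcs.
Qed.

Lemma arclength_hull_complementary_le I n : complementary_arcs E I ->
  (arclength (dyadic_hull n `&` I) <= arclength I)%E.
Proof.
move=> CI; have mI := measurable_complementary_arcs CI.
apply: le_measure => //; rewrite ?inE//.
by apply: measurableI => //; exact: measurable_dyadic_hull.
Qed.

(** A dyadic arc longer than [I] which meets [I] also meets [E]. *)
Lemma complementary_sub_hull I n : complementary_arcs E I ->
  (arclength I < ((2 ^+ n)^-1)%:E)%E -> I `<=` dyadic_hull n.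
Proof.
move=> CI In z Iz.
have [k kn kz] := dyadic_arc_cover n (complementary_arcs_circle CI Iz).
exists (Ordinal kn) => //=; rewrite in_generation; apply/asboolP.
apply: contrapT => nkE; move: In; rewrite -(arclength_dyadic_arc R kn).
apply/negP; rewrite -leNgt; apply: le_measure => //; rewrite ?inE.
- exact: measurable_dyadic_arc.
- exact: measurable_complementary_arcs.
- by apply: dyadic_arc_complementary => //; exists z.
Qed.

(** At most two of the arcs which make up the hull meet [I]. *)
Lemma arclength_hull_complementary_le2 I n : complementary_arcs E I ->
  (arclength (dyadic_hull n `&` I) <= (2 / 2 ^+ n)%:E)%E.
Proof.
move=> CI; set K := fun p => dyadic_arc R p `&` E !=set0 /\
                             dyadic_arc R p `&` I !=set0.
apply: (@le_trans _ _ (arclength (dyadic_union R (generation K n)))).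
  apply: le_measure => //; rewrite ?inE.
  - apply: measurableI; first exact: measurable_dyadic_hull.
    exact: measurable_complementary_arcs.
  - exact: measurable_dyadic_union.
  move=> z [[k /= kE kz] Iz]; exists k => //=; move: kE.
  rewrite !in_generation => /asboolP kE; apply/asboolP.
  by split=> //; exists z.
rewrite arclength_dyadic_union lee_fin ler_pM2r ?invr_gt0 ?pow2_gt0//.
rewrite ler_nat card_meets_both//; first exact: complementary_arcs_connected.
exact: complementary_arcs_sub.
Qed.

End complementary_arcs.

(** * Entropy and dyadic arcs *)

Section entropy.
Variables (R : realType) (E : set (R * R)).
Hypotheses (E_circle : E `<=` circle R) (E_closed : closed E).

(** The sum of the lengths of the dyadic arcs meeting [E] is finite. *)
Definition dyadic_summable : Prop :=
  (\esum_(p in [set p | dyadic_index p /\ dyadic_arc R p `&` E !=set0])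
     arclength (dyadic_arc R p) < +oo)%E.

Lemma esum_dyadic_hull :
  \esum_(p in [set p | dyadic_index p /\ dyadic_arc R p `&` E !=set0])
     arclength (dyadic_arc R p) = (\sum_(n <oo) arclength (dyadic_hull E n))%E.
Proof.
rewrite (esum_generation R (meets E)); apply: eq_eseriesr => n _.
by rewrite arclength_dyadic_union.
Qed.

Lemma ln2_itv : 2^-1 <= ln (2 : R) <= 1.
Proof.
apply/andP; split; last by have := @le_ln1Dx R 1; rewrite -[1 + 1]/2; apply; lra.
have := @le_ln1Dx R (- 2^-1); have -> : 1 + - 2^-1 = 2^-1 :> R by field.
by rewrite lnV ?posrE//; lra.
Qed.

(** The number of generations of dyadic arcs longer than [l] is comparable
   to the logarithm of [l^-1]: it is the least [n] with [2 ^- n <= l]. *)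
Lemma dyadic_scale (l : R) : 0 < l <= 1 -> exists n,
  [/\ (2 ^+ n)^-1 <= l, forall m, (m < n)%N -> l < (2 ^+ m)^-1,
      ln l^-1 <= n%:R & n%:R <= 2 * ln l^-1 + 1].
Proof.
move=> /andP[l0 l1]; have /andP[ln2 ln2'] := ln2_itv.
have ex : exists n, (2 ^+ n)^-1 <= l.
  exists (Num.trunc l^-1); have l0' : 0 <= l^-1 by rewrite invr_ge0 ltW.
  have /andP[_ h] := truncn_itv l0'.
  rewrite invf_ple ?posrE ?pow2_gt0//; apply: le_trans (ltW h) _.
  by rewrite -natrX ler_nat ltn_expl.
have lnX m : ln (2 ^+ m : R) = m%:R * ln 2 by rewrite lnXn// mulr_natl.
case: (ex_minnP ex) => n nl nmin; exists n; split=> //.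
- by move=> m mn; rewrite ltNge; apply/negP => /nmin; rewrite leqNgt mn.
- apply: (@le_trans _ _ (ln (2 ^+ n))).
    by rewrite ler_ln ?posrE ?invr_gt0 ?pow2_gt0// invf_ple ?posrE ?pow2_gt0.
  by rewrite lnX ler_piMr.
- have ll : 0 <= ln l^-1 by rewrite ln_ge0// invf_ge1.
  case: n {nl} nmin => [_|n nmin]; first by lra.
  have nl : 2 ^+ n <= l^-1.
    rewrite -[leLHS]invrK lef_pV2 ?posrE ?invr_gt0 ?pow2_gt0//.
    rewrite leNgt; apply/negP => /ltW /nmin; by rewrite ltnn.
  have : ln (2 ^+ n) <= ln l^-1 by rewrite ler_ln ?posrE ?invr_gt0 ?pow2_gt0.
  rewrite lnX -natr1; have : n%:R * 2^-1 <= n%:R * ln 2 :> R by rewrite ler_wpM2l.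
  lra.
Qed.

(** [I] is contained in the hulls of the generations of the arcs longer than it. *)
Lemma dyadic_entropy_le I : complementary_arcs E I ->
  ((fine (arclength I) * ln (fine (arclength I))^-1)%:E <=
   \sum_(n <oo) arclength (dyadic_hull E n `&` I))%E.
Proof.
move=> CI; have lI := arclength_complementary_itv E_closed CI.
have fI := arclength_complementary_fin_num E_closed CI.
have [n [_ nlt nln _]] := dyadic_scale lI.
apply: (@le_trans _ _ (\sum_(0 <= m < n) arclength (dyadic_hull E m `&` I))%E);
  last exact: nneseries_lim_ge.
rewrite big_mkord (eq_bigr (fun=> arclength I)) => [|m _]; last first.
  rewrite setIidr//; apply: complementary_sub_hull => //.
  by rewrite -(fineK fI) lte_fin nlt.
rewrite -(fineK fI) sumEFin lee_fin sumr_const card_ord -mulr_natr.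
by rewrite ler_wpM2l// ltW; case/andP: lI.
Qed.

Lemma dyadic_entropy_ge I : complementary_arcs E I ->
  (\sum_(n <oo) arclength (dyadic_hull E n `&` I) <=
   2%:E * (fine (arclength I) * ln (fine (arclength I))^-1)%:E
   + 5%:E * arclength I)%E.
Proof.
move=> CI; have lI := arclength_complementary_itv E_closed CI.
have fI := arclength_complementary_fin_num E_closed CI.
have [n [nle _ _ nln]] := dyadic_scale lI.
set l := fine (arclength I) in lI nle nln *.
have -> : arclength I = l%:E by rewrite fineK.
have fh m := arclength_hull_complementary_fin_num E_closed m CI.
pose f m := fine (arclength (dyadic_hull E m `&` I)).
have f0 m : 0 <= f m by rewrite fine_ge0.
have f1 m : f m <= l.
  by rewrite -lee_fin /f !fineK//; exact: arclength_hull_complementary_le.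
have f2 m : f m <= 2 / 2 ^+ m.
  by rewrite -lee_fin /f fineK//; exact: arclength_hull_complementary_le2.
have /andP[l0 _] := lI.
(* the first [n] generations contribute at most [l] each, and generation [m] at
   most [2 / 2 ^+ m] after that *)
have bound N : \sum_(m < n + N) f m <= n%:R * l + 4 / 2 ^+ n - 4 / 2 ^+ (n + N).
  elim: N => [|N IH].
    rewrite addn0 addrK mulr_natl -[X in _ <= _ *+ X]card_ord -sumr_const.
    exact: ler_sum.
  rewrite addnS big_ord_recr /= exprS.
  have := f2 (n + N)%N; move: IH; rewrite invfM.
  move: (\sum_(m < n + N) _) (f _) ((2 ^+ (n + N))^-1) ((2 ^+ n)^-1) (n%:R * l).
  by move=> a b c d e; lra.
apply: lime_le; first exact: is_cvg_nneseries.
apply: nearW => N /=; rewrite big_mkord.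
apply: (@le_trans _ _ (\sum_(m < n + N) f m)%:E); last first.
  rewrite -!EFinM -EFinD lee_fin; apply: le_trans (bound N) _.
  have : 0 <= 4 / 2 ^+ (n + N) :> R by rewrite divr_ge0// ltW// pow2_gt0.
  have : n%:R * l <= (2 * ln l^-1 + 1) * l by rewrite ler_wpM2r// ltW.
  move: nle; move: ((2 ^+ n)^-1) (_ / 2 ^+ (n + N)) (n%:R * l) (ln l^-1) => a b c d.
  nra.
rewrite -sumEFin (eq_bigr (fun m : 'I_N => (f m)%:E)) => [|m _]; last first.
  by rewrite /f fineK.
rewrite -!(big_mkord xpredT (fun m => (f m)%:E)).
rewrite [leRHS](@big_cat_nat _ _ _ N)//= ?leq_addl// leeDl// sume_ge0// => m _.
by rewrite lee_fin.
Qed.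

Lemma entropy_term_ge0 I : complementary_arcs E I ->
  (0 <= (fine (arclength I) * ln (fine (arclength I))^-1)%:E)%E.
Proof.
move=> /(arclength_complementary_itv E_closed)/andP[l0 l1].
by rewrite lee_fin mulr_ge0 ?(ltW l0)// ln_ge0// invf_ge1.
Qed.

Lemma esum_hull_complementary :
  \esum_(I in complementary_arcs E)
     (\sum_(n <oo) arclength (dyadic_hull E n `&` I))%E =
  (\sum_(n <oo)
     \esum_(I in complementary_arcs E) arclength (dyadic_hull E n `&` I))%E.
Proof.
transitivity (\esum_(I in complementary_arcs E)
    \esum_(n in [set: nat]) arclength (dyadic_hull E n `&` I)).
  by apply: eq_esum => I _; rewrite nneseries_esumT.
rewrite exchange_esum// nneseries_esumT// => n; exact: esum_ge0.
Qed.

Lemma esum_complementary_le (A : set (R * R)) : measurable A ->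
  (\esum_(I in complementary_arcs E) arclength (A `&` I) <= arclength A)%E.
Proof.
move=> mA; apply: ge_ereal_sup => _ [X [finX XC] <-].
have mI I : X I -> measurable (A `&` I).
  move=> /XC CI; apply: measurableI => //.
  exact: measurable_complementary_arcs CI.
rewrite -measure_fin_bigcup//; last first.
  move=> I J /XC CI /XC CJ [z [[_ Iz] [_ Jz]]].
  by apply: trivIset_complementary_arcs CI CJ _; exists z.
apply: le_measure; rewrite ?inE//; first exact: fin_bigcup_measurable.
by move=> z [I _ []].
Qed.

Lemma dyadic_summable_null : dyadic_summable -> arclength E = 0%E.
Proof.
rewrite /dyadic_summable esum_dyadic_hull => Sy.
have mE := closed_plane_measurable E_closed.
have fE := arclength_fin_num mE E_circle.
apply/eqP; rewrite eq_le measure_ge0 andbT leNgt; apply/negP => E0.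
move: Sy; apply/negP; rewrite -leNgt leye_eq; apply/eqP.
apply/eqyP => B B0.
have e0 : 0 < fine (arclength E) by rewrite fine_gt0// E0 -ge0_fin_numE.
pose N := (Num.trunc (B / fine (arclength E))).+1.
apply: (@le_trans _ _ (\sum_(0 <= n < N) arclength (dyadic_hull E n))%E);
  last exact: nneseries_lim_ge.
apply: (@le_trans _ _ (\sum_(0 <= n < N) arclength E)%E); last first.
  apply: lee_sum => n _; apply: le_measure; rewrite ?inE//.
    exact: measurable_dyadic_hull.
  exact: sub_dyadic_hull.
rewrite big_mkord -(fineK fE) sumEFin lee_fin sumr_const card_ord -mulr_natr.
rewrite mulrC -ler_pdivrMr//.
by have /andP[_ /ltW] := truncn_itv (divr_ge0 (ltW B0) (ltW e0)).
Qed.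

Lemma dyadic_summable_entropy : dyadic_summable -> finite_entropy E.
Proof.
rewrite /dyadic_summable esum_dyadic_hull; apply: le_lt_trans.
apply: (@le_trans _ _ (\esum_(I in complementary_arcs E)
     (\sum_(n <oo) arclength (dyadic_hull E n `&` I))%E)).
  by apply: le_esum => I CI; exact: dyadic_entropy_le.
rewrite esum_hull_complementary; apply: lee_nneseries => [n _ _|n _].
  exact: esum_ge0.
by apply: esum_complementary_le; exact: measurable_dyadic_hull.
Qed.

Lemma entropy_dyadic_summable : arclength E = 0%E -> finite_entropy E ->
  dyadic_summable.
Proof.
move=> E0 entE; rewrite /dyadic_summable esum_dyadic_hull.
have mE := closed_plane_measurable E_closed.
apply: (@le_lt_trans _ _ (\esum_(I in complementary_arcs E)
     (\sum_(n <oo) arclength (dyadic_hull E n `&` I))%E)).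
  rewrite esum_hull_complementary; apply: lee_nneseries => // n _.
  have mh := measurable_dyadic_hull E n.
  have hE : dyadic_hull E n = (dyadic_hull E n `&` E) `|`
      \bigcup_(I in complementary_arcs E) (dyadic_hull E n `&` I).
    rewrite -setI_bigcupr bigcup_complementary_arcs -setIUr setUDr ?setDv ?setD0.
    apply/seteqP; split=> z; last by case.
    by move=> zh; split=> //; right; exact: dyadic_union_circle zh.
  rewrite [in leLHS]hE.
  have mU : measurable (\bigcup_(I in complementary_arcs E) (dyadic_hull E n `&` I)).
    rewrite -setI_bigcupr bigcup_complementary_arcs; apply: measurableI => //.
    by apply: measurableD => //; exact: measurable_circle.
  apply: (@le_trans _ _ (arclength (dyadic_hull E n `&` E) +
      arclength (\bigcup_(I in complementary_arcs E) (dyadic_hull E n `&` I)))%E).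
    apply: measureU2 => //; exact: measurableI.
  rewrite (_ : arclength (dyadic_hull E n `&` E) = 0%E) ?add0e; last first.
    apply/eqP; rewrite eq_le measure_ge0 andbT -E0; apply: le_measure => //;
      rewrite ?inE//; exact: measurableI.
  apply: (@measure_bigcup_esum _ _ _ _ (@arclength R)).
    exact: countable_complementary_arcs.
  move=> I CI; apply: measurableI => //.
  exact: measurable_complementary_arcs CI.
apply: (@le_lt_trans _ _ (\esum_(I in complementary_arcs E)
    (2%:E * (fine (arclength I) * ln (fine (arclength I))^-1)%:E
     + 5%:E * arclength I))%E).
  by apply: le_esum => I CI; exact: dyadic_entropy_ge.
rewrite esumD; last 2 first.
- by move=> I CI; rewrite mule_ge0// entropy_term_ge0.
- by move=> I CI; rewrite mule_ge0.
apply: lte_add_pinfty.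
  apply: le_lt_trans (esumM_le _ _) _ => //; first by move=> I; exact: entropy_term_ge0.
  by rewrite lte_mul_pinfty.
apply: le_lt_trans (esumM_le _ _) _ => //.
rewrite lte_mul_pinfty//; apply: (@le_lt_trans _ _ (arclength (circle R))).
  apply: le_trans (esum_complementary_le (@measurable_circle R)).
  apply: le_esum => I CI; rewrite setIidr//; exact: complementary_arcs_circle CI.
by rewrite arclength_circle ltry.
Qed.

End entropy.

(** * The Poisson kernel at dyadic points *)

Section poisson_kernel.
Variable R : realType.
Implicit Types (n m k l : nat) (t s : R) (z xi : R * R).
Local Notation ang := (dyadic_angle R).

(** The Poisson kernel of the disc, for [z] in the disc and [xi] on the circle. *)
Definition poisson_kernel z xi : R := (1 - sqmod z) / sqmod (xi - z).

(** The angle of the center of a dyadic arc. *)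
Definition center_angle n k : R := (ang n k + ang n k.+1) / 2.

Lemma center_angle_itv n k : ang n k <= center_angle n k < ang n k.+1.
Proof.
have := dyadic_angle_lt R n k k.+1; rewrite ltnSn /center_angle => h.
by apply/andP; split; lra.
Qed.

Lemma dyadic_pointE n k : (k < 2 ^ n)%N -> dyadic_point R (n, k) =
  ((1 - 3 / 4 / 2 ^+ n) * cos (center_angle n k),
   (1 - 3 / 4 / 2 ^+ n) * sin (center_angle n k)).
Proof. by move=> kn; rewrite /dyadic_point arclength_dyadic_arc. Qed.

Lemma sqmod_dyadic_point n k : (k < 2 ^ n)%N ->
  sqmod (dyadic_point R (n, k)) = (1 - 3 / 4 / 2 ^+ n) ^+ 2.
Proof.
move=> kn; rewrite dyadic_pointE// /sqmod /=.
by rewrite [in LHS]exprMn [X in _ + X]exprMn -mulrDr cos2Dsin2 mulr1.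
Qed.

Lemma sqmod_expiB_dyadic_point n k t : (k < 2 ^ n)%N ->
  sqmod (expi t - dyadic_point R (n, k)) = (3 / 4 / 2 ^+ n) ^+ 2
    + 4 * (1 - 3 / 4 / 2 ^+ n) * sin ((t - center_angle n k) / 2) ^+ 2.
Proof.
move=> kn; rewrite dyadic_pointE//.
have := sqmod_expiB t (center_angle n k); rewrite /sqmod /=.
have := cos2Dsin2 t; have := cos2Dsin2 (center_angle n k).
move: (cos _) (sin _) (cos _) (sin _) (sin _) (3 / 4 / _) => a b c d e q ab cd ce.
have -> : 4 * (1 - q) * b ^+ 2 = (1 - q) * (4 * b ^+ 2) by ring.
rewrite -ce.
have -> : q ^+ 2 + (1 - q) * ((a - c) ^+ 2 + (d - e) ^+ 2) =
  q ^+ 2 + (1 - q) * ((a ^+ 2 + d ^+ 2) + (c ^+ 2 + e ^+ 2)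
  - 2 * (a * c + d * e)) by ring.
have -> : (a - (1 - q) * c) ^+ 2 + (d - (1 - q) * e) ^+ 2 =
  (a ^+ 2 + d ^+ 2) + (1 - q) ^+ 2 * (c ^+ 2 + e ^+ 2)
  - 2 * (1 - q) * (a * c + d * e) by ring.
by rewrite ab cd; ring.
Qed.

Lemma sqmod_ge0 z : 0 <= sqmod z.
Proof. by rewrite addr_ge0// sqr_ge0. Qed.

Lemma sqmod_dyadic_point_le1 n k : (k < 2 ^ n)%N ->
  sqmod (dyadic_point R (n, k)) < 1.
Proof.
move=> kn; rewrite sqmod_dyadic_point//; have := inv_pow2_itv R n.
by move: (_^-1) => q /andP[q0 q1]; nra.
Qed.

Lemma poisson_kernel_ge0 n k xi : (k < 2 ^ n)%N ->
  0 <= poisson_kernel (dyadic_point R (n, k)) xi.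
Proof.
by move=> kn; rewrite divr_ge0 ?sqmod_ge0// subr_ge0 ltW// sqmod_dyadic_point_le1.
Qed.

(** With [q] the length of the arc, the numerator is at least [3 / 4 * q] and the
   denominator at most [(9 / 16 + 16) * q ^ 2], because [pi <= 4]; the constant is
   the quotient of [3 / 4] by [17]. *)
Lemma poisson_kernel_ge n k t : (k < 2 ^ n)%N -> ang n k <= t <= ang n k.+1 ->
  3 / 68 * 2 ^+ n <= poisson_kernel (dyadic_point R (n, k)) (expi t).
Proof.
move=> kn tk; rewrite /poisson_kernel sqmod_dyadic_point// sqmod_expiB_dyadic_point//.
have := inv_pow2_itv R n; rewrite -[X in _ * X](@invrK R).
set q := (_^-1) => /andP[q0 q1].
have t2 : ((t - center_angle n k) / 2) ^+ 2 <= 4 * q ^+ 2.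
  have := pihalf_lt2 R; have := pi_gt0 R; move: tk.
  rewrite /center_angle dyadic_angle_width -/q.
  move: (ang n k) pi => a p /andP[h1 h2] p0 p2.
  have -> : 4 * q ^+ 2 = (2 * q) ^+ 2 by ring.
  rewrite -[leLHS]real_normK ?num_real//.
  rewrite ler_sqr ?nnegrE ?mulr_ge0 ?(ltW q0)// ler_norml; nra.
have sn := le_trans (sin_sqr_le _) t2.
have s0 := sqr_ge0 (sin ((t - center_angle n k) / 2)).
rewrite ler_pdivlMr; last by nra.
have -> : 3 / 68 * q^-1 * ((3 / 4 * q) ^+ 2 +
    4 * (1 - 3 / 4 * q) * sin ((t - center_angle n k) / 2) ^+ 2) =
  3 / 68 * (9 / 16 * q + 4 * (1 - 3 / 4 * q) *
    (sin ((t - center_angle n k) / 2) ^+ 2 / q)) by field; rewrite gt_eqF.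
have : sin ((t - center_angle n k) / 2) ^+ 2 / q <= 4 * q.
  by rewrite ler_pdivrMr//; move: sn; rewrite expr2 mulrA.
have : 0 <= sin ((t - center_angle n k) / 2) ^+ 2 / q by rewrite divr_ge0// ltW.
move: (_ / q) => e e0 eq; nra.
Qed.

(** A point of the circle at which the kernel exceeds [K] is close to the center
   of the arc. *)
Lemma poisson_kernel_lt n k t (K : R) : (k < 2 ^ n)%N -> 0 < K ->
  K < poisson_kernel (dyadic_point R (n, k)) (expi t) ->
  sin ((t - center_angle n k) / 2) ^+ 2 < 3 / 2 / K / 2 ^+ n.
Proof.
move=> kn K0; rewrite /poisson_kernel sqmod_dyadic_point// sqmod_expiB_dyadic_point//.
have := inv_pow2_itv R n; set q := (_^-1) => /andP[q0 q1].
have := sqr_ge0 (sin ((t - center_angle n k) / 2)).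
move: (sin _ ^+ 2) => s s0; rewrite ltr_pdivlMr; last by nra.
move=> h; rewrite -mulrA [_^-1 * q]mulrC mulrA ltr_pdivlMr//.
have : s * K <= 4 * (1 - 3 / 4 * q) * (s * K).
  by rewrite ler_peMl ?mulr_ge0 ?(ltW K0)//; lra.
have : 0 <= K * (3 / 4 * q) ^+ 2 by rewrite mulr_ge0 ?sqr_ge0 ?(ltW K0).
have := mulr_gt0 q0 q0; nra.
Qed.

(** Two points of the circle at distance less than [2 * 2 ^- m] lie in the same arc
   of generation [m] or in two cyclically consecutive ones. *)
Lemma dyadic_neighbours m k l t s : (k < 2 ^ m)%N -> (l < 2 ^ m)%N ->
  ang m k <= t < ang m k.+1 -> ang m l <= s < ang m l.+1 ->
  `|sin ((t - s) / 2)| < (2 ^+ m)^-1 ->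
  [\/ l = k, l = (k.+1 %% 2 ^ m)%N | l = ((k + 2 ^ m).-1 %% 2 ^ m)%N].
Proof.
move=> km lm tk sl; have pi0 := pi_gt0 R.
have half (x : R) : 0 <= x <= pi -> sin x < (2 ^+ m)^-1 ->
    2 * x < 2 * pi / 2 ^+ m \/ 2 * pi - 2 * pi / 2 ^+ m < 2 * x.
  move=> /andP[x0 x1] sx.
  have E : 2 * pi / 2 ^+ m = 4 * (pi / 2 ^+ m.+1) :> R.
    by rewrite exprS invfM; move: (_ ^-1) => q; field.
  rewrite E; have [xp|xp] := leP x (pi / 2).
    left; have := @sin_lt_dyadic R x m; rewrite x0 xp => /(_ isT sx).
    have : 0 < pi / 2 ^+ m.+1 :> R by rewrite divr_gt0// pow2_gt0.
    lra.
  right; have := @sin_lt_dyadic R (pi - x) m.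
  have -> : sin (pi - x) = sin x by rewrite sinB sinpi cospi; ring.
  move=> H; have := H ltac:(lra) sx.
  have : 0 < pi / 2 ^+ m.+1 :> R by rewrite divr_gt0// pow2_gt0.
  lra.
have last_angle : ang m (2 ^ m).-1 = 2 * pi - 2 * pi / 2 ^+ m.
  have := dyadic_angle_width R m (2 ^ m).-1.
  by rewrite prednK ?expn_gt0// dyadic_angle_full; lra.
have angle1 : ang m 1 = 2 * pi / 2 ^+ m.
  by rewrite dyadic_angle_width dyadic_angle0 add0r.
(* [a <= b]: the third case is that of arcs on both sides of the angle zero *)
have main i j a b : (i < 2 ^ m)%N -> (j < 2 ^ m)%N ->
    ang m i <= a < ang m i.+1 -> ang m j <= b < ang m j.+1 -> a <= b ->
    `|sin ((b - a) / 2)| < (2 ^+ m)^-1 ->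
    [\/ j = i, j = i.+1 | i = 0%N /\ j = (2 ^ m).-1].
  move=> im jm ai bj ab sab.
  have ad := dyadic_angle_dom im ai; have bd := dyadic_angle_dom jm bj.
  have x0 : 0 <= (b - a) / 2 <= pi by lra.
  rewrite ger0_norm ?sin_ge0_pi// in sab.
  have ij : (i <= j)%N.
    by rewrite -ltnS -(dyadic_angle_lt R m); lra.
  have [h|h] := half _ x0 sab.
    have : (j < i.+2)%N.
      by rewrite -(dyadic_angle_lt R m) (dyadic_angle_width R m i.+1); lra.
    rewrite ltnS leq_eqVlt ltnS => /orP[/eqP|ji]; first by constructor 2.
    by constructor 1; apply/eqP; rewrite eqn_leq ji.
  constructor 3; split.
    have : (i < 1)%N by rewrite -(dyadic_angle_lt R m) angle1; lra.
    by case: (i).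
  have : ((2 ^ m).-1 < j.+1)%N by rewrite -(dyadic_angle_lt R m) last_angle; lra.
  rewrite ltnS => h'; apply/eqP; rewrite eqn_leq h' andbT -ltnS prednK ?expn_gt0//.
case: (leP t s) => ts.
  rewrite -normrN -sinN -mulNr opprB => h.
  have [kl|kl|[k0 l0]] := main _ _ _ _ km lm tk sl ts h.
  - by constructor 1.
  - by constructor 2; rewrite kl modn_small// -kl.
  - by constructor 3; rewrite k0 l0 add0n modn_small// prednK ?expn_gt0.
move=> h; have [kl|kl|[l0 k0]] := main _ _ _ _ lm km sl tk (ltW ts) h.
- by constructor 1.
- by constructor 3; rewrite kl addSn /= modnDr modn_small.
- by constructor 2; rewrite k0 l0 prednK ?expn_gt0// modnn.
Qed.

Lemma measurable_sqmod_sub z :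
  measurable_fun [set: R * R] (fun xi => sqmod (xi - z)).
Proof.
apply: measurable_funD; apply: measurable_funX; apply: measurable_funB => //.
Qed.

Lemma measurable_poisson_kernel z : sqmod z < 1 ->
  measurable_fun (circle R) (poisson_kernel z).
Proof.
move=> z1; apply: measurable_funM; first exact: measurable_cst.
apply: (@measurable_comp _ _ _ _ _ _ [set x : R | 0 < x] (fun x : R => x^-1)).
- rewrite (_ : [set x | 0 < x] = `]0, +oo[%classic); first exact: measurable_itv.
  by apply/seteqP; split=> x; rewrite /= in_itv /= andbT.
- move=> _ [xi xi1 <-] /=; rewrite lt_neqAle sqmod_ge0 andbT eq_sym.
  apply/negP; rewrite paddr_eq0 ?sqr_ge0// !sqrf_eq0 !subr_eq0.
  move=> /andP[/eqP e1 /eqP e2].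
  by move: xi1 z1; rewrite /circle /sqmod /= e1 e2 => ->; rewrite ltxx.
- apply: open_continuous_measurable_fun.
    rewrite (_ : [set x | 0 < x] = `]0, +oo[%classic); first exact: interval_open.
    by apply/seteqP; split=> x; rewrite /= in_itv /= andbT.
  by move=> x; rewrite inE /= => x0; apply: inv_continuous; rewrite gt_eqF.
- by apply: measurable_funTS; exact: measurable_sqmod_sub.
Qed.

End poisson_kernel.

(** * Poisson integrals of measures supported by the set *)

Section poisson_upper.
Variables (R : realType) (E : set (R * R)).
Hypothesis E_circle : E `<=` circle R.
Variable mu : {finite_measure set (R * R)%type -> \bar R}.
Hypothesis muE : closed_support mu `<=` E.

Lemma finite_measureT : mu setT = (fine (mu setT))%:E.
Proof. by rewrite fineK// fin_num_measure. Qed.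

Lemma poisson_le n k (K : R) : (k < 2 ^ n)%N -> 0 <= K ->
  (forall xi, E xi -> poisson_kernel (dyadic_point R (n, k)) xi <= K) ->
  (poisson mu (dyadic_point R (n, k)) <= (K * fine (mu setT))%:E)%E.
Proof.
move=> kn K0 EK; have mc := @measurable_circle R.
have z1 := sqmod_dyadic_point_le1 R kn.
apply: (@le_trans _ _ (\int[mu]_(xi in circle R) (cst K%:E xi))%E).
  apply: ae_ge0_le_integral => //.
  - by move=> xi _; rewrite lee_fin poisson_kernel_ge0.
  - by apply/measurable_EFinP; exact: measurable_poisson_kernel.
  - apply: negligibleS (measure_setC_support muE) => xi /= nK Exi; apply: nK => _.
    by rewrite lee_fin; exact: EK.
rewrite integral_cst// EFinM -finite_measureT lee_wpmul2l ?lee_fin//.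
by apply: le_measure; rewrite ?inE.
Qed.

(** Adding one to the total mass covers the case of the zero measure. *)
Lemma poisson_lt_kernel n k (C : R) : 0 < C -> (k < 2 ^ n)%N ->
  (C%:E <= poisson mu (dyadic_point R (n, k)))%E ->
  exists2 xi, E xi &
    C / (fine (mu setT) + 1) < poisson_kernel (dyadic_point R (n, k)) xi.
Proof.
move=> C0 kn CP; apply: contrapT => nE.
have M0 : 0 <= fine (mu setT) by rewrite fine_ge0.
have K0 : 0 <= C / (fine (mu setT) + 1) by rewrite divr_ge0 ?(ltW C0)// addr_ge0.
have := @poisson_le n k (C / (fine (mu setT) + 1)) kn K0.
move=> /(_ _)/(le_trans CP) H.
have {H} : (C%:E <= (C / (fine (mu setT) + 1) * fine (mu setT))%:E)%E.
  by apply: H => xi Exi; rewrite leNgt; apply/negP => h; apply: nE; exists xi.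
rewrite lee_fin mulrAC ler_pdivlMr; last by lra.
by rewrite mulrDr mulr1; lra.
Qed.

(** Where the Poisson integral is at least [C], the ancestor of generation [m] of
   the arc, or one of its two neighbours, meets [E], provided that [2 ^- m] is
   large with respect to the square root of the length of the arc. *)
Lemma poisson_ancestor n m k (C : R) : 0 < C -> (k < 2 ^ n)%N ->
  (m <= n)%N -> 3 / 2 * (fine (mu setT) + 1) / C * 4 ^+ m <= 2 ^+ n ->
  (C%:E <= poisson mu (dyadic_point R (n, k)))%E ->
  exists l : 'I_(2 ^ m), l \in generation (meets E) m /\
    [\/ (k %/ 2 ^ (n - m))%N = l, (k %/ 2 ^ (n - m))%N = ordS l
      | (k %/ 2 ^ (n - m))%N = ord_pred l].
Proof.
move=> C0 kn mn large CP.
have M0 : 0 <= fine (mu setT) by rewrite fine_ge0.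
have [xi Exi] := poisson_lt_kernel C0 kn CP.
have [t t0 txi] := circle_expi (E_circle Exi); rewrite -txi.
have K0 : 0 < C / (fine (mu setT) + 1) by rewrite divr_gt0//; lra.
move=> /(poisson_kernel_lt kn K0) small.
have [l lm tl] := dyadic_angle_index m t0.
exists (Ordinal lm); split.
  rewrite in_generation; apply/asboolP; exists xi; split=> //.
  by rewrite -txi; apply/dyadic_arcP.
have km : (k %/ 2 ^ (n - m) < 2 ^ m)%N.
  by rewrite ltn_divLR ?expn_gt0// -expnD subnKC.
have ck := center_angle_itv R n k; have cd := dyadic_angle_dom kn ck.
apply: (@dyadic_neighbours R m l _ t (center_angle R n k)) => //.
  apply/dyadic_arcP => //; apply: dyadic_arc_sub; rewrite subnKC//.
  exact/dyadic_arcP.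
rewrite -[ltLHS]normr_id -[ltRHS]ger0_norm ?invr_ge0 ?exprn_ge0//.
rewrite -ltr_sqr ?nnegrE// !real_normK ?num_real//; apply: lt_le_trans small _.
have E4 : 4 ^+ m = (2 ^+ m) ^+ 2 :> R.
  by rewrite -exprM mulnC exprM; congr (_ ^+ _); ring.
rewrite exprVn -E4 ler_pdivrMr ?pow2_gt0// ler_pdivlMl ?exprn_gt0//.
apply: le_trans large; rewrite le_eqVlt; apply/orP; left; apply/eqP.
by rewrite invf_div [LHS]mulrC !mulrA.
Qed.

(** Hence the total length of these arcs is at most three times that of the arcs of
   generation [m] which meet [E]. *)
Lemma poisson_generation_le n m (C : R) : 0 < C -> (m <= n)%N ->
  3 / 2 * (fine (mu setT) + 1) / C * 4 ^+ m <= 2 ^+ n ->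
  #|generation (fun p => (C%:E <= poisson mu (dyadic_point R p))%E) n|%:R / 2 ^+ n
  <= 3 * (#|generation (meets E) m|%:R / 2 ^+ m) :> R.
Proof.
move=> C0 mn large; set K := (fun p : nat * nat => _).
set V := generation (meets E) m.
pose W := (V :|: (@ordS _ @: V)%SET :|: (@ord_pred _ @: V)%SET)%SET.
have WV : (#|W| <= 3 * #|V|)%N.
  have h1 := leq_imset_card (@ordS (2 ^ m)) V.
  have h2 := leq_imset_card (@ord_pred (2 ^ m)) V.
  have h3 := (leq_card_setU (V :|: (@ordS _ @: V)%SET)%SET (@ord_pred _ @: V)%SET).1.
  have h4 := (leq_card_setU V (@ordS _ @: V)%SET).1.
  apply: leq_trans h3 _; apply: leq_trans (leq_add h4 h2) _.
  by rewrite !mulSn mul0n addn0 addnA leq_add2r leq_add2l.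
apply: (@le_trans _ _ (#|W|%:R / 2 ^+ m)); last first.
  by rewrite mulrA ler_pM2r ?invr_gt0 ?pow2_gt0// -natrM ler_nat.
rewrite -lee_fin -!arclength_dyadic_union; apply: le_measure; rewrite ?inE.
- exact: measurable_dyadic_union.
- exact: measurable_dyadic_union.
move=> z [k /= kK kz]; move: kK; rewrite in_generation => /asboolP CP.
have [l [lV lk]] := poisson_ancestor C0 (ltn_ord k) mn large CP.
have [j jW jk] : exists2 j : 'I_(2 ^ m), j \in W & (val k %/ 2 ^ (n - m))%N = j.
  case: lk => lk; [exists l => //|exists (ordS l) => //|exists (ord_pred l) => //].
  - by rewrite 2!finset.in_setU lV.
  - by rewrite 2!finset.in_setU (imset_f (@ordS _) lV) orbT.
  - by rewrite 2!finset.in_setU (imset_f (@ord_pred _) lV) orbT.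
exists j => //=; rewrite -[val j]jk; apply: dyadic_arc_sub; rewrite subnKC//.
Qed.

Lemma poisson_summable (C : R) : dyadic_summable E -> 0 < C ->
  (\esum_(p in [set p | dyadic_index p /\
                        (C%:E <= poisson mu (dyadic_point R p))%E])
      arclength (dyadic_arc R p) < +oo)%E.
Proof.
move=> SE C0; set K := (fun p : nat * nat => (C%:E <= poisson mu (dyadic_point R p))%E).
rewrite (esum_generation R K).
move: SE; rewrite /dyadic_summable (esum_generation R (meets E)).
pose u m : R := #|generation (meets E) m|%:R / 2 ^+ m.
pose a n : R := #|generation K n|%:R / 2 ^+ n.
have u0 m : 0 <= u m by exact: generation_ratio_ge0.
have a0 m : 0 <= a m by exact: generation_ratio_ge0.
move=> /(nneseries_lt_pinfty u0)[B uB]; apply/(nneseries_lt_pinfty a0).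
have M0 : 0 <= fine (mu setT) by rewrite fine_ge0.
pose A := 3 / 2 * (fine (mu setT) + 1) / C.
have A0 : 0 <= A by rewrite /A divr_ge0 ?(ltW C0)// mulr_ge0//; lra.
(* for [n >= 2 * (c + m)] the condition of the preceding lemma holds *)
have [c Ac] : exists c, A <= 4 ^+ c.
  exists (Num.trunc A).+1; have /andP[_ /ltW h] := truncn_itv A0; apply: le_trans h _.
  by rewrite -natrX ler_nat; apply: ltnW; exact: ltn_expl.
have aN m n : (2 * (c + m) <= n)%N -> a n <= 3 * u m.
  move=> mn; apply: poisson_generation_le => //; first by move: mn; lia.
  apply: (@le_trans _ _ (4 ^+ c * 4 ^+ m)); first by rewrite ler_pM2r ?exprn_gt0.
  have -> : 4 = 2 ^+ 2 :> R by ring.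
  by rewrite -exprD -exprM -!natrX ler_nat leq_exp2l.
(* the generations [2 * (c + m)] and [2 * (c + m) + 1] are compared with [m], and
   the first [2 * c] ones contribute at most one each *)
have bound N : \sum_(n < 2 * (c + N)) a n <= (2 * c)%:R + 6 * \sum_(m < N) u m.
  elim: N => [|N IH].
    rewrite big_ord0 mulr0 addr0 addn0 -[X in _ <= X%:R]card_ord -sumr_const.
    by apply: ler_sum => n _; exact: generation_ratio_le1.
  have -> : (2 * (c + N.+1) = (2 * (c + N)).+2)%N by lia.
  rewrite 2!big_ord_recr [in leRHS]big_ord_recr /=.
  have h1 := aN N (2 * (c + N))%N (leqnn _).
  have h2 := aN N (2 * (c + N)).+1 (leqnSn _).
  by move: IH h1 h2; lra.
exists ((2 * c)%:R + 6 * B) => N.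
apply: (@le_trans _ _ (\sum_(n < 2 * (c + N)) a n)); last first.
  by apply: le_trans (bound N) _; rewrite lerD2l ler_pM2l.
rewrite -!(big_mkord xpredT a) [leRHS](@big_cat_nat _ _ _ N)//=; last by lia.
by rewrite lerDl sumr_ge0.
Qed.

End poisson_upper.

(** * Measures with many large Poisson integrals *)

Section frostman.
Variables (R : realType) (E : set (R * R)).
Implicit Types (n m k j d : nat).

(* the point mass [2 ^- n] at [x] *)
Let point_mass n (x : R * R) : {measure set (R * R) -> \bar R} :=
  mscale (NngNum (ltW (andP (inv_pow2_itv R n)).1)) (dirac x).

Let point_massE n x A : A x -> point_mass n x A = ((2 ^+ n)^-1)%:E.
Proof.
move=> Ax; rewrite (_ : point_mass n x A = (((2 ^+ n)^-1)%:E * \d_x A)%E)//.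
by rewrite diracE mem_set// mule1.
Qed.

Let point_mass_out n x A : ~ A x -> point_mass n x A = 0%E.
Proof.
move=> Ax; rewrite (_ : point_mass n x A = (((2 ^+ n)^-1)%:E * \d_x A)%E)//.
by rewrite diracE memNset// mule0.
Qed.

(** A measure carried by finitely many points of [E] which, down to depth [d] below
   a dyadic arc of generation [n], gives to each arc meeting [E] at least its
   length, while its total mass does not exceed [2 ^- n]: the mass of an arc is
   divided equally between its two halves, and the share of a half which misses
   [E] is put on a point of [E] in the arc. *)
Lemma frostman_measure d n k : meets E (n, k) ->
  exists (nu : {measure set (R * R) -> \bar R}) (F : set (R * R)),
    [/\ finite_set F /\ F `<=` E, nu (~` F) = 0%E,
        (nu setT <= ((2 ^+ n)^-1)%:E)%E &
        forall m j, (n <= m <= n + d)%N -> (j %/ 2 ^ (m - n))%N = k ->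
          meets E (m, j) -> (((2 ^+ m)^-1)%:E <= nu (dyadic_arc R (m, j)))%E].
Proof.
elim: d n k => [|d IH] n k [x [xk Ex]].
  exists (point_mass n x), [set x]; split.
  - by split; [exact: finite_set1|move=> _ ->].
  - by apply: point_mass_out => /=; apply.
  - by rewrite point_massE.
  - move=> m j; rewrite addn0 => nm; have -> : m = n by lia.
    by rewrite subnn divn1 => -> _; rewrite point_massE//.
(* the share of the half [c] of the arc *)
have child c : (c %/ 2)%N = k -> exists (nu : {measure set (R * R) -> \bar R})
    (F : set (R * R)),
    [/\ finite_set F /\ F `<=` E, nu (~` F) = 0%E,
        (nu setT <= ((2 ^+ n.+1)^-1)%:E)%E,
        (((2 ^+ n.+1)^-1)%:E <= nu (dyadic_arc R (n, k)))%E &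
        forall m j, (n.+1 <= m <= n.+1 + d)%N -> (j %/ 2 ^ (m - n.+1))%N = c ->
          meets E (m, j) -> (((2 ^+ m)^-1)%:E <= nu (dyadic_arc R (m, j)))%E].
  move=> ck; have [cE|ncE] := pselect (meets E (n.+1, c)).
    have [nu [F [[finF FE] nuF nuT nuJ]]] := IH _ _ cE.
    exists nu, F; split=> //.
    apply: (@le_trans _ _ (nu (dyadic_arc R (n.+1, c)))).
      by apply: nuJ => //; rewrite ?leqnn ?leq_addr// subnn divn1.
    apply: le_measure; rewrite ?inE; try exact: measurable_dyadic_arc.
    by rewrite -ck -addn1; exact: dyadic_arc_sub.
  exists (point_mass n.+1 x), [set x]; split.
  - by split; [exact: finite_set1|move=> _ ->].
  - by apply: point_mass_out => /=; apply.
  - by rewrite point_massE.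
  - by rewrite point_massE//.
  - move=> m j mn jc [y [yj Ey]]; exfalso; apply: ncE; exists y; split=> //.
    by rewrite -jc; apply: dyadic_arc_sub; rewrite subnKC//; case/andP: mn.
have [|nu1 [F1 [[fin1 FE1] nu1F nu1T nu1k nu1J]]] := child (k * 2)%N.
  by rewrite mulnK.
have [|nu2 [F2 [[fin2 FE2] nu2F nu2T nu2k nu2J]]] := child (k * 2 + 1)%N.
  by rewrite divnMDl// addn0.
have halves : ((2 ^+ n)^-1)%:E = ((2 ^+ n.+1)^-1)%:E + ((2 ^+ n.+1)^-1)%:E :> \bar R.
  by rewrite -EFinD exprS invfM; congr EFin; move: (_^-1) => q; field.
have mF := @measurable_finite_plane R.
pose nu : {measure set (R * R) -> \bar R} := measure_add nu1 nu2.
have addE A : nu A = (nu1 A + nu2 A)%E by exact: measure_addE.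
exists nu, (F1 `|` F2).
split.
- by split; [rewrite finite_setU|move=> z [/FE1|/FE2]].
- rewrite addE; have m12 : measurable (~` (F1 `|` F2)).
    by apply: measurableC; apply: measurableU; exact: mF.
  have -> : nu1 (~` (F1 `|` F2)) = 0%E.
    apply/eqP; rewrite -measure_le0 -nu1F; apply: le_measure; rewrite ?inE//.
      by apply: measurableC; exact: mF.
    by apply: subsetC; left.
  have -> : nu2 (~` (F1 `|` F2)) = 0%E.
    apply/eqP; rewrite -measure_le0 -nu2F; apply: le_measure; rewrite ?inE//.
      by apply: measurableC; exact: mF.
    by apply: subsetC; right.
  by rewrite adde0.
- by rewrite addE halves; exact: leeD.
- move=> m j mn jk jE; rewrite addE; have [mn0|mn1] : m = n \/ (n.+1 <= m)%N by lia.
    move: jk; rewrite mn0 subnn divn1 => ->; rewrite halves; exact: leeD.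
  have mS : (m - n = (m - n.+1) + 1)%N by lia.
  have jS : ((j %/ 2 ^ (m - n.+1)) %/ 2)%N = k by rewrite -jk mS expnD divnMA.
  have := divn_eq (j %/ 2 ^ (m - n.+1)) 2; rewrite jS.
  have := ltn_pmod (j %/ 2 ^ (m - n.+1)) (isT : 0 < 2)%N.
  case: (_ %% 2)%N => [|[|//]] _ jc.
    apply: (@le_trans _ _ (nu1 (dyadic_arc R (m, j)))); last by rewrite leeDl.
    by apply: nu1J => //; [lia|rewrite jc addn0].
  apply: (@le_trans _ _ (nu2 (dyadic_arc R (m, j)))); last by rewrite leeDr.
  by apply: nu2J => //; lia.
Qed.

(** The dyadic arcs meeting [E] which are contained in the arc [(n, k)]. *)
Definition below n k : set (nat * nat) :=
  [set q | [/\ dyadic_index q, meets E q, (n <= q.1)%N &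
               (q.2 %/ 2 ^ (q.1 - n))%N = k]].

(** If the sum over the arcs meeting [E] diverges, then so does, in each generation,
   the part of it below some arc: the sum below an arc is its length plus the sums
   below its halves. *)
Lemma below_diverges n : ~ dyadic_summable E -> exists2 k, (k < 2 ^ n)%N &
  \esum_(q in below n k) arclength (dyadic_arc R q) = +oo%E.
Proof.
move=> nS; elim: n => [|n [k kn kD]].
  exists 0%N => //; apply/eqP; rewrite -leye_eq leNgt; apply/negP => h; apply: nS.
  apply: le_lt_trans h; apply: sub_esum => -[m j] [/= mj jE]; split=> //=.
  by rewrite subn0 divn_small.
have sub : below n k `<=` [set (n, k)] `|`
    (below n.+1 (k * 2) `|` below n.+1 (k * 2 + 1)).
  move=> [m j] [/= mj jE nm jk]; have [mn0|mn1] : m = n \/ (n.+1 <= m)%N by lia.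
    by left; rewrite /= -jk mn0 subnn divn1.
  right; have mS : (m - n = (m - n.+1) + 1)%N by lia.
  have jS : ((j %/ 2 ^ (m - n.+1)) %/ 2)%N = k by rewrite -jk mS expnD divnMA.
  have := divn_eq (j %/ 2 ^ (m - n.+1)) 2; rewrite jS.
  have := ltn_pmod (j %/ 2 ^ (m - n.+1)) (isT : 0 < 2)%N.
  case: (_ %% 2)%N => [|[|//]] _ jc; [left|right]; split=> //=.
  by rewrite jc addn0.
have [D1|D1] := eqVneq
    (\esum_(q in below n.+1 (k * 2)) arclength (dyadic_arc R q)) +oo%E.
  by exists (k * 2)%N => //; rewrite expnSr ltn_pmul2r.
exists (k * 2 + 1)%N; first by rewrite expnSr; move: kn; lia.
apply/eqP; apply/negPn/negP => D2.
have : (\esum_(q in below n k) arclength (dyadic_arc R q) < +oo)%E.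
  apply: le_lt_trans (sub_esum _ sub) _.
  apply: le_lt_trans (esum_setU_le _ _ _) _ => //.
  apply: lte_add_pinfty; first by rewrite esum_set1// arclength_dyadic_arc// ltry.
  apply: le_lt_trans (esum_setU_le _ _ _) _ => //.
  by apply: lte_add_pinfty; rewrite ltey.
by rewrite kD ltxx.
Qed.

(** The measure [nu] is small, but gives at least their length to the arcs in a set
   [X] of total length at least [i]. *)
Lemma divergent_measure i : ~ dyadic_summable E ->
  exists (nu : {measure set (R * R) -> \bar R}) (F : set (R * R))
    (X : set (nat * nat)),
    [/\ finite_set F /\ F `<=` E, nu (~` F) = 0%E,
        (nu setT <= ((2 ^+ i)^-1)%:E)%E,
        finite_set X /\ (i%:R%:E <= \sum_(q \in X) arclength (dyadic_arc R q))%E &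
        forall q, X q -> dyadic_index q /\
          (((2 ^+ q.1)^-1)%:E <= nu (dyadic_arc R q))%E].
Proof.
move=> nS; have [k ki kD] := below_diverges i nS.
have kE : meets E (i, k).
  apply: contrapT => nkE.
  suff : \esum_(q in below i k) arclength (dyadic_arc R q) = 0%E.
    by rewrite kD.
  rewrite (_ : below i k = set0) ?esum_set0// -subset0.
  move=> [m j] [/= mj [y [yj Ey]] im jk].
  apply: nkE; exists y; split=> //.
  by rewrite -jk; apply: dyadic_arc_sub; rewrite subnKC.
have [_ [X [finX Xb] <-] iX] : exists2 x, [set \sum_(q \in A) arclength (dyadic_arc R q)
    | A in fsets (below i k)]%E x & (i%:R%:E < x)%E.
  by apply: ereal_sup_gt; rewrite -/(esum _ _) kD ltry.
have [d Xd] : exists d, forall q, X q -> (q.1 <= i + d)%N.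
  exists (\max_(q <- finmap.enum_fset (fset_set X)) q.1)%N => q Xq.
  apply: leq_trans (leq_addl _ _).
  by apply: (@leq_bigmax_seq _ _ _ _ q) => //; rewrite in_fset_set ?inE.
have [nu [F [[finF FE] nuF nuT nuJ]]] := frostman_measure d kE.
exists nu, F, X; split=> //; first by split=> //; exact: ltW.
move=> [m j] Xq; have [/= mj jE im jk] := Xb _ Xq; split=> //.
by apply: nuJ => //; rewrite im (Xd (m, j)).
Qed.

(** The Poisson integral at [z(J)] controls the mean density of the measure on [J]. *)
Lemma poisson_ge n k (mu : {measure set (R * R) -> \bar R}) : (k < 2 ^ n)%N ->
  (((2 ^+ n)^-1)%:E <= mu (dyadic_arc R (n, k)))%E ->
  ((3 / 68)%:E <= poisson mu (dyadic_point R (n, k)))%E.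
Proof.
move=> kn muk; have mc := @measurable_circle R.
have ma := @measurable_dyadic_arc R (n, k).
have z1 := sqmod_dyadic_point_le1 R kn.
have ac : dyadic_arc R (n, k) `<=` circle R by exact: dyadic_arc_circle.
have mf : measurable_fun (circle R)
    (fun xi => (poisson_kernel (dyadic_point R (n, k)) xi)%:E).
  by apply/measurable_EFinP; exact: measurable_poisson_kernel.
have f0 xi : (0 <= (poisson_kernel (dyadic_point R (n, k)) xi)%:E)%E.
  by rewrite lee_fin poisson_kernel_ge0.
apply: (@le_trans _ _ (\int[mu]_(xi in dyadic_arc R (n, k))
    (poisson_kernel (dyadic_point R (n, k)) xi)%:E)%E); last first.
  exact: ge0_subset_integral.
apply: (@le_trans _ _ (\int[mu]_(xi in dyadic_arc R (n, k))
    (cst (3 / 68 * 2 ^+ n)%:E xi))%E); last first.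
  apply: ge0_le_integral => //.
  - by move=> xi _; rewrite lee_fin mulr_ge0// exprn_ge0.
  - exact: measurable_funS mf.
  - move=> _ [t + <-]; rewrite /= in_itv /= => /andP[t1 t2].
    by rewrite lee_fin poisson_kernel_ge// t1 ltW.
rewrite integral_cst//.
apply: (@le_trans _ _ ((3 / 68 * 2 ^+ n)%:E * ((2 ^+ n)^-1)%:E)%E).
  by rewrite -EFinM lee_fin mulfK// gt_eqF// pow2_gt0.
by rewrite lee_wpmul2l// lee_fin mulr_ge0// exprn_ge0.
Qed.

End frostman.

Section poisson_test.
Variables (R : realType) (E : set (R * R)).
Hypothesis E_closed : closed E.

(** Otherwise the sum of a sequence of measures provided by [divergent_measure], of
   masses at most [2 ^- i], would violate the hypothesis for [C = 3 / 68]. *)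
Lemma poisson_test_summable :
  (forall (mu : {finite_measure set (R * R)%type -> \bar R}) (C : R),
     singular mu -> closed_support mu `<=` E -> 0 < C ->
     (\esum_(p in [set p | dyadic_index p /\
                           (C%:E <= poisson mu (dyadic_point R p))%E])
         arclength (dyadic_arc R p) < +oo)%E) ->
  dyadic_summable E.
Proof.
move=> test; apply: contrapT => nS.
have /boolp.choice[nu] := fun i => divergent_measure i nS.
move=> /boolp.choice[F] /boolp.choice[X] H.
pose mu : {measure set (R * R) -> \bar R} := mseries nu 0.
have muT : (mu setT < +oo)%E.
  apply: (@le_lt_trans _ _ (\sum_(i <oo) ((2 ^+ i)^-1)%:E)%E).
    by apply: lee_nneseries => // i _; have [_ _ + _ _] := H i.
  have pos i : 0 <= (2 ^+ i)^-1 :> R by rewrite invr_ge0 exprn_ge0.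
  apply/(nneseries_lt_pinfty pos); exists 2 => N.
  suff : \sum_(i < N) (2 ^+ i)^-1 <= 2 - 2 / 2 ^+ N :> R.
    have : 0 <= 2 / 2 ^+ N :> R by rewrite divr_ge0// exprn_ge0.
    lra.
  elim: N => [|N IH]; first by rewrite big_ord0 expr0 divr1 subrr.
  rewrite big_ord_recr /= exprS invfM; move: IH; move: (_^-1) => q; lra.
have [m mE] := finite_measure_lty muT.
pose N := \bigcup_i F i.
have finF i : finite_set (F i) by have [[? _] _ _ _ _] := H i.
have mF i : measurable (F i) by exact: measurable_finite_plane.
have mN : measurable N by exact: bigcup_measurable.
have NE : N `<=` E by move=> z [i _]; have [[_ +] _ _ _ _] := H i; apply.
have muN : m (~` N) = 0%E.
  rewrite mE /mu /= /mseries eseries0// => i _ _.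
  have [_ nuF _ _ _] := H i; apply/eqP; rewrite -measure_le0 -nuF.
  apply: le_measure; rewrite ?inE; try exact: measurableC.
  by apply: subsetC => z Fz; exists i.
have sing : singular m.
  exists N; split=> //; apply: arclength_countable.
  by apply: bigcup_countable => // i _; exact: finite_set_countable.
have supp : closed_support m `<=` E.
  move=> z zm; apply: contrapT => nEz.
  have := zm _ (closed_openC E_closed) nEz; apply/negP; rewrite -leNgt -muN.
  apply: le_measure; rewrite ?inE; try exact: measurableC.
    by apply: measurableC; exact: closed_plane_measurable.
  exact: subsetC.
have C0 : 0 < 3 / 68 :> R by rewrite divr_gt0.
have := test m (3 / 68) sing supp C0; apply/negP; rewrite -leNgt leye_eq.
apply/eqP/eqyP => B B0; pose i := (Num.trunc B).+1.
apply: (@le_trans _ _ i%:R%:E).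
  by rewrite lee_fin; have /andP[_ /ltW] := truncn_itv (ltW B0).
have [_ _ _ [finX iX] Xi] := H i.
apply: le_trans iX _; apply: esum_ge; exists (X i) => //.
split=> // -[n k] /Xi[/= kn nuk]; split=> //; apply: poisson_ge => //.
apply: le_trans nuk _; rewrite mE /mu /= /mseries.
apply: (@le_trans _ _ (\sum_(0 <= j < i.+1) nu j (dyadic_arc R (n, k)))%E).
  by rewrite big_nat_recr//= leeDr// sume_ge0.
exact: nneseries_lim_ge.
Qed.

End poisson_test.

(** * The equivalence *)

Theorem lemma1 (R : realType) (E : set (R * R))
    (E_circle : E `<=` circle R) (E_closed : closed E) :
  [<-> arclength E = 0%E /\ finite_entropy E ;
       (\esum_(p in [set p | dyadic_index p /\ dyadic_arc R p `&` E !=set0])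
          arclength (dyadic_arc R p) < +oo)%E ;
       (forall (mu : {finite_measure set (R * R)%type -> \bar R}) (C : R),
         singular mu -> closed_support mu `<=` E -> 0 < C ->
         (\esum_(p in [set p | dyadic_index p /\
                              (C%:E <= poisson mu (dyadic_point R p))%E])
            arclength (dyadic_arc R p) < +oo)%E) ].
Proof.
split; first by move=> [E0 entE]; exact: entropy_dyadic_summable.
split=> [SE mu C _ muE C0|test]; first exact: (poisson_summable E_circle muE).
have SE : dyadic_summable E by exact: poisson_test_summable.
split; first exact: dyadic_summable_null.
exact: dyadic_summable_entropy.
Qed.
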